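(* For the Lipschitz MAB problem there is an algorithm $\mathcal{A}$ and an absolute constant $c_0$ such that for every metric space $(L,X)$ of diameter at most $1$, every problem instance on it, every $c>0$, with $d$ the $c$-zooming dimension of the instance: (1) with $\beta=2$, and (2) if moreover $\mu^*=1$, also with $\beta=1$, the following hold: if $d+\beta>1$ then $R_{\mathcal{A}}(t)\le O(c\,c_0\log^2 t)^{1/(d+\beta)}\,t^{1-1/(d+\beta)}$ for all $t\ge2$; if $d+\beta\le 1$ then $R_{\mathcal{A}}(t)\le O(c\,c_0\log^2 t)$ for all $t\ge 2$ (absolute constants in $O(\cdot)$).
   Context: Lipschitz MAB problem on $(L,X)$ of diameter $\le1$: unknown $\mu:X\to[0,1]$ with $|\mu(x)-\mu(y)|\le L(x,y)$; playing $x$ yields an independent sample from a distribution on $[0,1]$ with mean $\mu(x)$; the algorithm may query which strategies are covered by a finite set of open balls. $\mu^*=\sup_X\mu$. Regret $R_{\mathcal{A}}(t)=t\mu^*-W_{\mathcal{A}}(t)$ with $W_{\mathcal{A}}(t)$ the expected total payoff in the first $t$ rounds. $c$-zooming dimension: smallest $d$ such that for every $r\in(0,1]$ the set $\{x: r/2<\mu^*-\mu(x)\le r\}$ can be covered by $c\,r^{-d}$ sets of diameter at most $r/8$. *)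

(* Defs.v *)
From HB Require Import structures.
From mathcomp Require Import all_boot all_order all_algebra.
From mathcomp Require Import all_classical all_reals all_analysis.
From mathcomp Require Import Rstruct Rstruct_topology.

Set Implicit Arguments.
Unset Strict Implicit.
Unset Printing Implicit Defensive.

Import Order.TTheory GRing.Theory Num.Theory.
Local Open Scope classical_set_scope.
Local Open Scope ring_scope.

Definition RR : realType := Rdefinitions.R.

Definition is_metric (X : Type) (L : X -> X -> RR) : Prop :=
  (forall x y, 0 <= L x y) /\
  (forall x y, L x y = 0 <-> x = y) /\
  (forall x y, L x y = L y x) /\
  (forall x y z, L x z <= L x y + L y z).

Definition covering_oracle (X : Type) (L : X -> X -> RR)
  (O : seq (X * RR) -> option X) : Prop :=
  forall bs : seq (X * RR),
    match O bs return Prop with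
    | None => forall x, has (fun b => L b.1 x < b.2) bs
    | Some y => ~ has (fun b => L b.1 y < b.2) bs
    end.

(** * Algorithms.
    An algorithm never sees the points of X directly: it refers to the
    strategies it has discovered so far by handles (their index, in order
    of discovery).  Its observations are events: *)
Inductive event :=
| ECovered
| ENew of seq RR                (* the oracle returned a new (uncovered) strategy;
                                   its distances to all previously discovered
                                   strategies, in order of discovery, are revealed *)
| EReward of RR.

Inductive action :=
| AQuery of seq (nat * RR)      (* covering query: open balls given by
                                   (handle of the center, radius) *)
| APlay of nat.

Definition algorithm := seq event -> action.

(** * Expected total payoff.
    [payoff_fuel ... n t h pts]: expected total payoff collected in the
    remaining at most [t] rounds, when at most [n] further interaction steps
    (queries or plays) are performed, from history [h] with discovered
    strategies [pts].  Balls whose center handle is invalid are ignored;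
    playing an invalid handle uses up a round with payoff 0. *)
Fixpoint payoff_fuel (X : Type) (L : X -> X -> RR)
  (O : seq (X * RR) -> option X) (P : X -> probability RR RR)
  (A : algorithm) (n t : nat) (h : seq event) (pts : seq X) : \bar RR :=
  match n, t with
  | 0%N, _ => 0%E
  | _, 0%N => 0%E
  | n'.+1, t'.+1 =>
    match A h with
    | AQuery bs =>
      let balls := pmap (fun b => omap (fun x => (x, b.2)) (onth pts b.1)) bs in
      match O balls with
      | None => payoff_fuel L O P A n' t (rcons h ECovered) pts
      | Some y => payoff_fuel L O P A n' t
                    (rcons h (ENew [seq L p y | p <- pts])) (rcons pts y)
      end
    | APlay i =>
      match onth pts i with
      | Some x => (\int[P x]_(r in `[0%R, 1%R])
                     (r%:E + payoff_fuel L O P A n' t' (rcons h (EReward r)) pts))%E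
      | None => payoff_fuel L O P A n' t' (rcons h (EReward 0)) pts
      end
    end
  end.

(** W_A(t): expected total payoff in the first t rounds (supremum over the
    number of interaction steps; rounds never reached count as payoff 0). *)
Definition exp_payoff (X : Type) (L : X -> X -> RR)
  (O : seq (X * RR) -> option X) (P : X -> probability RR RR)
  (A : algorithm) (t : nat) : \bar RR :=
  ereal_sup (range (fun n => payoff_fuel L O P A n t [::] [::])).

Definition mustar (X : Type) (mu : X -> RR) : RR := sup (range mu).

Definition regret (X : Type) (L : X -> X -> RR)
  (O : seq (X * RR) -> option X) (P : X -> probability RR RR) (mu : X -> RR)
  (A : algorithm) (t : nat) : \bar RR :=
  ((t%:R * mustar mu)%:E - exp_payoff L O P A t)%E.

Definition instance (X : Type) (L : X -> X -> RR) (mu : X -> RR)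
  (P : X -> probability RR RR) : Prop :=
  (forall x y, `|mu x - mu y| <= L x y) /\
  (forall x, P x `[0%R, 1%R]%classic = 1%E) /\
  (forall x, (\int[P x]_r r%:E)%E = (mu x)%:E).

Definition zooming_ok (X : Type) (L : X -> X -> RR) (mu : X -> RR) (c d : RR) : Prop :=
  forall r : RR, 0 < r <= 1 ->
    exists (N : nat) (S : 'I_N -> set X),
      N%:R <= c * r `^ (- d) /\
      (forall i x y, S i x -> S i y -> L x y <= r / 8) /\
      [set x | r / 2 < mustar mu - mu x <= r] `<=` \bigcup_(i in setT) S i.

Definition zooming_dim (X : Type) (L : X -> X -> RR) (mu : X -> RR) (c d : RR) : Prop :=
  zooming_ok L mu c d /\ (forall d', zooming_ok L mu c d' -> d <= d').

(* Main.v *)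
(* Zooming, in phases of doubly exponential length so that the horizon is known
   up to a square.  Each active arm x carries a confidence radius of order
   A / m + sqrt (A l) / m, where A is the log of the phase length and l the
   cumulative loss after m plays; this is of order sqrt (A / m) in general, and
   leads to m <= O(A / Delta x) when mu* = 1, since then the mean loss is Delta x.
   A point outside the confidence balls becomes a new arm, so every point is
   covered when an arm of maximal upper confidence index is played, which gives
   Delta x <= O(radius of x).  Hence arms with Delta > r / 2 are more than r / 8
   apart, the zooming condition bounds their number by c r^-d, and each is played
   O(A Delta^-beta) times.

   Concentration is handled without random variables: the expected payoff is
   defined by nested integrals, and we bound it below by backward induction with
   a value that contains an exponential supermartingale.  A pointwise
   quadratic bound on exp makes that value affine in the last reward, so that no
   measurability of the strategy is needed.

   No multiplicative constant can be lost outside the power 1 / (d + beta), as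
   d may be large.  With tau := (K c ln^2 t / t)^(1 / (d + beta)), the arms with
   Delta <= tau / 2 cost at most tau t / 2, and the shells above tau / 2 have radii
   r >= tau, so that they contribute O(c ln^2 t) tau^(1 - d - beta) = O(tau t / K). *)
Require Import Defs.
From HB Require Import structures.
From mathcomp Require Import all_boot all_order all_algebra.
From mathcomp Require Import all_classical all_reals all_analysis.
From mathcomp Require Import Rstruct Rstruct_topology.
From mathcomp Require Import measurable_realfun exp.
From mathcomp Require Import ring lra zify.
Import Order.TTheory GRing.Theory Num.Theory.
Local Open Scope classical_set_scope.
Local Open Scope ring_scope.
Set Implicit Arguments.
Unset Strict Implicit.
Unset Printing Implicit Defensive.

(** * Means on the unit interval *)

(* The library's monotonicity lemmas ask for measurability of both sides; here
   the larger function is arbitrary. *)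
Import HBNNSimple.

Lemma ge0_le_integral_lower {d} {T : measurableType d} {R : realType}
    (m : {measure set T -> \bar R}) (D : set T) (g f : T -> \bar R) :
  (forall x, D x -> 0 <= g x)%E -> (forall x, D x -> g x <= f x)%E ->
  (\int[m]_(x in D) g x <= \int[m]_(x in D) f x)%E.
Proof.
move=> g0 gf.
rewrite ge0_integralE// ge0_integralE//; last first.
  by move=> x Dx; apply: le_trans (gf x Dx); exact: g0.
apply: le_ereal_sup => _ [h/= hg <-]; exists h => // x; apply: (le_trans (hg x)).
rewrite /patch; case: ifPn => // /set_mem Dx; exact: gf.
Qed.

Section mean_on_full_set.
Context {d} {T : measurableType d} {R : realType} (m : probability T R).
Context (I : set T) (X : T -> R) (mean : R).
Hypothesis mI : measurable I.
Hypothesis mX : measurable_fun setT X.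
Hypothesis X01 : forall x, I x -> 0 <= X x <= 1.
Hypothesis mI1 : m I = 1%E.
Hypothesis meanE : (\int[m]_x (X x)%:E)%E = mean%:E.

Lemma integral_full_set : (\int[m]_(x in I) (X x)%:E)%E = mean%:E.
Proof.
have mC : m (~` I) = 0%E by rewrite probability_setC// mI1 subee.
have mXE : measurable_fun setT (EFin \o X) by exact/measurable_EFinP.
rewrite -meanE -(setUv I) integral_setU//; last 3 first.
- exact: measurableC.
- by rewrite setUv.
- exact/disj_setPCl.
rewrite (null_set_integral _ _ mC) ?adde0//; first exact: measurableC.
exact: measurable_funTS.
Qed.

Lemma integrable_full_set : m.-integrable I (EFin \o X).
Proof.
apply/integrableP; split; first by apply: measurable_funTS; exact/measurable_EFinP.
rewrite (eq_integral (EFin \o X)) ?integral_full_set ?ltry// => x /set_mem /X01 /andP[x0 _].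
by rewrite /= ger0_norm.
Qed.

Lemma integrable_affine (a b : R) : m.-integrable I (fun x => (a + b * X x)%:E).
Proof.
have -> : (fun x => (a + b * X x)%:E) = ((cst a%:E) \+ (fun x => b%:E * (EFin \o X) x))%E by [].
apply: integrableD => //; first exact: finite_measure_integrable_cst.
by apply: integrableZl => //; exact: integrable_full_set.
Qed.

Lemma integral_affine (a b : R) :
  (\int[m]_(x in I) (a + b * X x)%:E)%E = (a + b * mean)%:E.
Proof.
under eq_integral do rewrite EFinD EFinM.
rewrite integralD//; last 2 first.
- exact: finite_measure_integrable_cst.
- by apply: integrableZl => //; exact: integrable_full_set.
rewrite (integral_cst m mI) integralZl//; last exact: integrable_full_set.
by rewrite integral_full_set [X in (_ * X + _)%E]mI1 mule1 -EFinM -EFinD.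
Qed.

(** The integral of an affine function depends on the mean alone. As [f] is nonnegative, it also
    dominates the positive part of the affine bound, which [ge0_le_integral_lower] can take as lower
    function. *)
Lemma integral_ge_affine (a b : R) (f : T -> \bar R) :
  (forall x, I x -> 0 <= f x)%E ->
  (forall x, I x -> (a + b * X x)%:E <= f x)%E ->
  ((a + b * mean)%:E <= \int[m]_(x in I) f x)%E.
Proof.
move=> f0 fab.
pose g x := (a + b * X x)%:E.
apply: (@le_trans _ _ (\int[m]_(x in I) (g^\+)%E x)%E); last first.
  apply: ge0_le_integral_lower => x Ix; first exact: funepos_ge0.
  by rewrite funeposE ge_max fab// f0.
rewrite -integral_affine; apply: le_integral => //.
- exact: integrable_affine.
- by apply: integrable_funepos => //; exact: integrable_affine.
- by move=> x _; rewrite funeposE le_max lexx.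
Qed.

Lemma mean_full_set : 0 <= mean <= 1.
Proof.
apply/andP; split; rewrite -lee_fin.
  rewrite -integral_full_set; apply: integral_ge0 => x /X01 /andP[x0 _]; rewrite lee_fin//.
have -> : 1%:E = (\int[m]_(x in I) (cst 1) x)%E.
  by rewrite (integral_cst m mI) [X in (_ * X)%E]mI1 mule1.
rewrite -[mean]add0r -[mean]mul1r; apply: integral_ge_affine => // x /X01 /andP[x0 x1].
by rewrite add0r mul1r lee_fin.
Qed.

End mean_on_full_set.

(** * An exponential supermartingale *)

Section exponential_bounds.
Context {R : realType}.
Implicit Types (z A nu th l y : R) (a : nat * R).

(** From [1 - z <= expR (- z)], since (1 - z) (1 + z + 2 z^2) = 1 + z^2 (1 - 2 z) >= 1. *)
Lemma expR_le_quadratic z : `|z| <= 2^-1 -> expR z <= 1 + z + 2 * z ^+ 2.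
Proof.
rewrite ler_norml => /andP[z1 z2].
have h : 1 - z <= expR (- z) by exact: expR_ge1Dx.
have e0 := expR_gt0 z.
have : expR z * (1 - z) <= 1.
  rewrite -[leRHS](expRxMexpNx_1 z) ler_pM2l//.
nra.
Qed.

Lemma expR_half_le2 : expR (2^-1 : R) <= 2.
Proof.
have := expR_ge1Dx (- 2^-1 : R); have := expRxMexpNx_1 (2^-1 : R).
have := expR_gt0 (2^-1 : R); nra.
Qed.

Lemma exp2_le_expR (n : nat) : (2 ^ n)%:R <= expR n%:R :> R.
Proof.
rewrite natrX -[n%:R]mulr1 expRM_natl lerXn2r// ?nnegrE ?expR_ge0//.
by have := expR_ge1Dx (1 : R); lra.
Qed.

Lemma ln2_ge_half : 2^-1 <= ln (2 : R).
Proof. by rewrite -ler_expR lnK ?posrE// expR_half_le2. Qed.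

(* An arm is recorded as a = (m, l): one plus its number of plays, and its
   cumulative loss, a play with reward r incurring the loss 1 - r. *)
Definition tilt nu th a : R :=
  th * (a.2 - a.1%:R * nu) - 2 * a.1%:R * nu * th ^+ 2.

(** A mixture over a grid of tilts, because the best tilt depends on a number of plays not known in
    advance. The two signs serve the two tails; [k.+2] keeps the tilt within 1/2, where the
    quadratic bound on exp holds. *)
Definition potential (K : nat) A nu a : R :=
  \sum_(k < K) expR (- A) *
    (expR (tilt nu k.+2%:R^-1 a) + expR (tilt nu (- k.+2%:R^-1) a)).

(** With c = th + 2 th^2, the quadratic bound and y^2 <= y give exp (th y) <= 1 + c y, while exp (-
    c nu) (1 + c nu) <= 1. The correction [b * (y - nu)] vanishes in mean. *)
Lemma tilt_step nu th (m : nat) l : 0 <= nu <= 1 -> `|th| <= 2^-1 ->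
  exists b, forall y, 0 <= y <= 1 ->
    expR (tilt nu th (m.+1, l + y)) <= expR (tilt nu th (m, l)) + b * (y - nu).
Proof.
move=> /andP[n0 n1] ht; pose c := th + 2 * th ^+ 2.
pose E := expR (tilt nu th (m, l)).
exists (E * expR (- (c * nu)) * c) => y /andP[y0 y1].
have -> : tilt nu th (m.+1, l + y) = tilt nu th (m, l) + (- (c * nu)) + th * y.
  by rewrite /tilt/= /c -natr1; ring.
rewrite 2!expRD -/E.
have E0 : 0 <= E by exact: expR_ge0.
have h1 : expR (th * y) <= 1 + c * y.
  apply: le_trans (expR_le_quadratic _) _.
    rewrite normrM (ger0_norm y0).
    by move: ht; have := normr_ge0 th; nra.
  have : 0 <= th ^+ 2 * (y * (1 - y)).
    by apply: mulr_ge0; [exact: sqr_ge0 | nra].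
  rewrite /c; nra.
have h2 : expR (- (c * nu)) * (1 + c * nu) <= 1.
  rewrite -[leRHS](expRxMexpNx_1 (c * nu)) mulrC ler_pM2r ?expR_gt0//.
  exact: expR_ge1Dx.
have e0 := expR_ge0 (- (c * nu)).
have : E * expR (- (c * nu)) * expR (th * y) <= E * expR (- (c * nu)) * (1 + c * y).
  by apply: ler_wpM2l => //; exact: mulr_ge0.
have : E * (expR (- (c * nu)) * (1 + c * nu)) <= E by rewrite -[leRHS]mulr1 ler_wpM2l.
set e := expR (- (c * nu)); lra.
Qed.

Lemma invr_nat2_le_half (k : nat) : `|k.+2%:R^-1| <= 2^-1 :> R.
Proof.
by rewrite ger0_norm// lef_pV2 ?posrE// ler_nat.
Qed.

Lemma potential_step K A nu m l : 0 <= nu <= 1 ->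
  exists b, forall y, 0 <= y <= 1 ->
    potential K A nu (m.+1, l + y) <= potential K A nu (m, l) + b * (y - nu).
Proof.
move=> n01.
have /choice[b hb] (k : 'I_K) : exists b, forall y, 0 <= y <= 1 ->
    expR (- A) * (expR (tilt nu k.+2%:R^-1 (m.+1, l + y)) +
                  expR (tilt nu (- k.+2%:R^-1) (m.+1, l + y))) <=
    expR (- A) * (expR (tilt nu k.+2%:R^-1 (m, l)) +
                  expR (tilt nu (- k.+2%:R^-1) (m, l))) + b * (y - nu).
  have [b1 h1] := @tilt_step nu k.+2%:R^-1 m l n01 (invr_nat2_le_half k).
  have [|b2 h2] := @tilt_step nu (- k.+2%:R^-1) m l n01.
    by rewrite normrN; exact: invr_nat2_le_half.
  exists (expR (- A) * (b1 + b2)) => y y01.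
  rewrite -mulrA -mulrDr ler_wpM2l ?expR_ge0//.
  have := h1 y y01; have := h2 y y01; lra.
exists (\sum_k b k) => y y01.
rewrite /potential mulr_suml -big_split/=; apply: ler_sum => k _; exact: hb.
Qed.

Lemma potential_ge0 K A nu a : 0 <= potential K A nu a.
Proof. by apply: sumr_ge0 => k _; rewrite mulr_ge0 ?addr_ge0 ?expR_ge0. Qed.

Lemma potential_init K A nu : 0 <= nu <= 1 ->
  potential K A nu (1%N, 0) <= K%:R * (4 * expR (- A)).
Proof.
move=> /andP[n0 n1].
have h (th : R) : `|th| <= 2^-1 -> expR (tilt nu th (1%N, 0)) <= 2.
  move=> ht; apply: le_trans expR_half_le2; rewrite ler_expR /tilt/=.
  move: ht; rewrite ler_norml => /andP[]; have := sqr_ge0 th; nra.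
rewrite /potential -[K in leRHS]card_ord mulr_natl -sumr_const; apply: ler_sum => k _.
have h1 := h _ (invr_nat2_le_half k).
have h2 : expR (tilt nu (- k.+2%:R^-1) (1%N, 0)) <= 2.
  by apply: h; rewrite normrN; exact: invr_nat2_le_half.
by rewrite mulrC ler_wpM2r ?expR_ge0//; lra.
Qed.

(** A sum of nonnegative terms below 1 keeps each exponent at most [A], for both signs of the tilt;
    multiplying by [k.+2] isolates the deviation. *)
Lemma potential_lt1 K A nu a (k : nat) : (k < K)%N -> potential K A nu a < 1 ->
  `|a.2 - a.1%:R * nu| <= A * k.+2%:R + 2 * (a.1%:R * nu) / k.+2%:R.
Proof.
move=> kK h.
have k0 : 0 < k.+2%:R :> R by [].
have : expR (- A) *
    (expR (tilt nu k.+2%:R^-1 a) + expR (tilt nu (- k.+2%:R^-1) a)) < 1.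
  apply: le_lt_trans h; rewrite /potential (bigD1 (Ordinal kK))//= lerDl.
  by apply: sumr_ge0 => j _; rewrite mulr_ge0 ?addr_ge0 ?expR_ge0.
have small (x y : R) : expR (- A) * (expR x + expR y) < 1 -> x <= A.
  move=> hx; rewrite -subr_le0 -ler_expR expR0 addrC expRD.
  by apply: le_trans (ltW hx); rewrite ler_wpM2l ?expR_ge0// lerDl expR_ge0.
move=> hk.
have h1 := small _ _ hk; rewrite addrC in hk; have {hk}h2 := small _ _ hk.
set D := a.2 - _ in h1 h2 *.
move: h1 h2; rewrite /tilt -/D => h1 h2.
have e1 : k.+2%:R * k.+2%:R^-1 = 1 :> R by rewrite divff ?gt_eqF.
set i := k.+2%:R^-1 in h1 h2 e1 *; set n := k.+2%:R in k0 h1 h2 e1 *.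
set p := a.1%:R * nu.
have ep : 2 * a.1%:R * nu = 2 * p by rewrite /p; ring.
rewrite ep sqrrN in h2; rewrite ep in h1.
have f1 : n * (i * D - 2 * p * i ^+ 2) = (n * i) * D - 2 * p * (n * i) * i by ring.
have f2 : n * (- i * D - 2 * p * i ^+ 2) = - ((n * i) * D) - 2 * p * (n * i) * i by ring.
have g1 : n * (i * D - 2 * p * i ^+ 2) <= n * A by rewrite ler_pM2l.
have g2 : n * (- i * D - 2 * p * i ^+ 2) <= n * A by rewrite ler_pM2l.
rewrite f1 e1 in g1; rewrite f2 e1 in g2.
rewrite ler_norml; apply/andP; split; lra.
Qed.

(* The free parameter k is balanced at sqrt (m nu / A). *)
Lemma potential_deviation K A nu a : 1 <= A -> 0 <= nu <= 1 -> (0 < a.1 < K)%N ->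
  potential K A nu a < 1 ->
  `|a.2 - a.1%:R * nu| <= 3 * (Num.sqrt A * Num.sqrt (a.1%:R * nu)) + 2 * A.
Proof.
move=> A1 /andP[n0 n1] /andP[m0 mK] hp.
set p := a.1%:R * nu.
have p0 : 0 <= p by rewrite mulr_ge0.
set s := Num.sqrt A; set u := Num.sqrt p.
have s1 : 1 <= s by rewrite -(sqrtr1) ler_wsqrtr.
have sA : s ^+ 2 = A by rewrite sqr_sqrtr//; lra.
have u0 : 0 <= u by exact: sqrtr_ge0.
have up : u ^+ 2 = p by rewrite sqr_sqrtr.
have us0 : 0 <= u / s by rewrite divr_ge0//; lra.
pose k := Num.truncn (u / s).
have /andP[k1 k2] := truncn_itv us0; rewrite -/k in k1 k2.
have es : u = (u / s) * s by rewrite divfK// gt_eqF//; lra.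
set v := u / s in es us0 k1 k2.
have m1 : 1 <= a.1%:R :> R by rewrite ler1n.
(* The index is on the grid: v <= u because s >= 1, and u^2 <= m, so v <= m < K. *)
have kK : (k < K)%N.
  rewrite -(ltr_nat R); apply: (@le_lt_trans _ _ (a.1%:R : R)); last by rewrite ltr_nat.
  apply: le_trans k1 _.
  have : v <= u by nra.
  have : u ^+ 2 <= a.1%:R by rewrite up /p -[leRHS]mulr1 ler_wpM2l.
  nra.
have := potential_lt1 kK hp; rewrite -/p => h; apply: (le_trans h).
have kv : v <= k.+2%:R by move: k2; rewrite -[k.+2%:R]natr1; lra.
have k2v : k.+2%:R <= v + 2 :> R by move: k1; rewrite -[k.+2%:R]natr1 -[k.+1%:R]natr1; lra.
have kp : 0 < k.+2%:R :> R by [].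
have : 2 * p / k.+2%:R <= 2 * A * v.
  rewrite ler_pdivrMr// -up es -sA.
  have : s ^+ 2 * v * v <= s ^+ 2 * v * k.+2%:R.
    by apply: ler_wpM2l => //; rewrite mulr_ge0 ?sqr_ge0.
  nra.
have : A * k.+2%:R <= A * (v + 2) by rewrite ler_wpM2l//; lra.
have -> : s * u = A * v by rewrite es -sA; ring.
by move: (A * k.+2%:R) (2 * p / k.+2%:R) => X Y; lra.
Qed.

(** With u^2 the predicted and w^2 the observed loss, the hypothesis forces u <= w + 4 a and w <= u
    + 2 a. The radius can thus be computed from [w] alone (14 = 2 + 3 * 4) and still be controlled
    by [u] (20 = 14 + 3 * 2). *)
Lemma sqr_deviation (a u w : R) : 0 < a -> 0 <= u -> 0 <= w ->
  `|w ^+ 2 - u ^+ 2| <= 3 * (a * u) + 2 * a ^+ 2 ->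
  `|w ^+ 2 - u ^+ 2| <= 14 * a ^+ 2 + 3 * (a * w) /\
  14 * a ^+ 2 + 3 * (a * w) <= 20 * a ^+ 2 + 3 * (a * u).
Proof.
move=> a0 u0 w0 h.
move: (h); rewrite ler_norml => /andP[h1 h2].
have uw : u <= w + 4 * a.
  rewrite leNgt; apply/negP => hlt.
  have : 4 * a * (u + w) <= (u - w) * (u + w) by rewrite ler_wpM2r//; lra.
  nra.
have wu : w <= u + 2 * a.
  rewrite leNgt; apply/negP => hlt; nra.
split; last nra.
apply: (le_trans h); nra.
Qed.

(** 160 = 8 * 20 and 24 = 8 * 3 arise from [sqr_deviation] for a gap of at most 8 radii; z <= 30 a
    because 160 + 24 * 30 < 30^2. *)
Lemma quadratic_bound (a z : R) : 0 <= a -> 0 <= z ->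
  z ^+ 2 <= 160 * a ^+ 2 + 24 * (a * z) -> z ^+ 2 <= 900 * a ^+ 2.
Proof.
move=> a0 z0 h.
have : z <= 30 * a by rewrite leNgt; apply/negP => hlt; nra.
nra.
Qed.

End exponential_bounds.

(** * Packing *)

Section powR_base_le1.
Context {R : realType}.
Implicit Types x y e : R.

Lemma powR_base_antitone x y e : 0 < x -> x <= y -> e <= 0 -> y `^ e <= x `^ e.
Proof.
move=> x0 xy e0; have y0 : 0 < y by exact: lt_le_trans xy.
rewrite -[e]opprK (powRN x) (powRN y) lef_pV2 ?posrE ?powR_gt0//.
have ne0 : 0 <= - e by rewrite oppr_ge0.
by apply: (ge0_ler_powR ne0) => //; rewrite nnegrE ltW.
Qed.

Lemma powR_le1 x e : 0 <= x <= 1 -> 0 <= e -> x `^ e <= 1.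
Proof.
move=> /andP[x0 x1] e0; have -> : 1 = 1 `^ e :> R by rewrite powR1.
by apply: (ge0_ler_powR e0) => //; rewrite nnegrE.
Qed.

Lemma powR_le_base x e : 0 < x <= 1 -> 1 <= e -> x `^ e <= x.
Proof.
move=> /andP[x0 x1] e1; have -> : x `^ e = x * x `^ (e - 1).
  rewrite -[X in X * _]powRr1 ?(ltW x0)// -powRD; last by rewrite (gt_eqF x0) implybT.
  by rewrite addrC subrK.
by rewrite -[leRHS]mulr1 ler_pM2l// powR_le1 ?(ltW x0)// subr_ge0.
Qed.

End powR_base_le1.

Definition gap (X : Type) (mu : X -> RR) (x : X) : RR := mustar mu - mu x.

(** The gap is that of the earlier point, the arm whose confidence ball the later point avoided. *)
Definition gap_separated (X : Type) (L : X -> X -> RR) (mu : X -> RR) :=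
  pairwise (fun x y => gap mu x / 4 <= L x y).

Section packing.
Context {X : Type} (L : X -> X -> RR) (mu : X -> RR) (c d : RR).
Hypothesis zoom : zooming_ok L mu c d.
Local Notation Delta := (gap mu).

(* A covering set has diameter at most r / 8, hence contains at most one point
   of a gap-separated sequence in the shell, where the gap exceeds r / 2. *)
Lemma shell_size (r : RR) (ys : seq X) : 0 < r <= 1 ->
  gap_separated L mu ys -> all (fun x => r / 2 < Delta x <= r) ys ->
  (size ys)%:R <= c * r `^ (- d).
Proof.
move=> r01 sep shell; have [N [S [NS [diam cover]]]] := zoom r01.
apply: le_trans NS; rewrite ler_nat.
have [->//|ys0] := eqVneq (size ys) 0%N.
have N0 : (0 < N)%N.
  case: ys shell ys0 {sep} => // y ys /= /andP[hy _] _.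
  by have [i _ _] := cover y hy; exact: leq_ltn_trans (ltn_ord i).
have /choice[f fP] (x : X) : exists i : 'I_N, r / 2 < Delta x <= r -> S i x.
  have [hx|_] := boolP (r / 2 < Delta x <= r); last by exists (Ordinal N0).
  by have [i _ Si] := cover x hx; exists i.
have : uniq (map f ys).
  rewrite uniq_pairwise pairwise_map.
  apply: (sub_in_pairwise _ shell sep) => x y /= hx hy hxy.
  apply/eqP => fxy; have := diam (f x) x y (fP x hx); rewrite fxy => /(_ (fP y hy)).
  by move: hx => /andP[hx _]; lra.
by move=> /card_uniqP; rewrite size_map => <-; rewrite -[leqRHS]card_ord max_card.
Qed.

(** The shell of outer radius [Delta x] contains [x], so its cover has at least one set. This is the
    source of all lower bounds on [c]. *)
Lemma gap_coefficient_ge1 (x : X) : 0 < Delta x <= 1 -> 1 <= c * Delta x `^ (- d).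
Proof.
move=> D01; apply: (@shell_size _ [:: x]) => //.
by rewrite /= lexx !andbT; move: D01 => /andP[D0 _]; lra.
Qed.

(** Take the least k with D <= 2^k tau: minimality gives the lower bound, or the hypothesis on
    [tau / 2] if k = 0. Truncation at 1 keeps the radius in the range of the zooming condition. *)
Lemma dyadic_shell (tau D : RR) (M : nat) : 0 < tau <= 1 -> 1 <= 2 ^+ M * tau ->
  tau / 2 < D <= 1 ->
  exists k : 'I_M.+1, Num.min (2 ^+ k * tau) 1 / 2 < D <= Num.min (2 ^+ k * tau) 1.
Proof.
move=> /andP[tau0 tau1] M1 /andP[D0 D1].
have ex : exists k, D <= 2 ^+ k * tau by exists M; exact: le_trans M1.
case: (ex_minnP ex) => k hk kmin.
have kM : (k < M.+1)%N by rewrite ltnS; apply: kmin; exact: le_trans M1.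
exists (Ordinal kM); rewrite /= le_min hk D1 !andbT.
apply: (@le_lt_trans _ _ (2 ^+ k * tau / 2)).
  by rewrite ler_wpM2r// ge_min lexx.
case: k hk kmin {kM} => [|k] hk kmin; first by rewrite expr0 mul1r.
rewrite ltNge; apply/negP => hlt.
suff : (k.+1 <= k)%N by rewrite ltnn.
apply: kmin; apply: (le_trans hlt); rewrite exprS; lra.
Qed.

(* Each of the M + 1 shells, of radii 2 ^ k tau truncated at 1, contributes at
   most 2 c r `^ (1 - (d + beta)). *)
Lemma weighted_packing (beta tau : RR) (M : nat) (xs : seq X) :
  0 < c -> 1 <= beta <= 2 -> 0 < tau <= 1 -> 1 <= 2 ^+ M * tau ->
  (forall x, Delta x <= 1) -> gap_separated L mu xs ->
  \sum_(x <- xs | tau / 2 < Delta x) Delta x `^ (1 - beta) <=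
  2 * c * M.+1%:R * Num.max 1 (tau `^ (1 - (d + beta))).
Proof.
move=> c0 /andP[b1 b2] /andP[tau0 tau1] M1 D1 sep.
pose r (k : 'I_M.+1) := Num.min (2 ^+ k * tau) 1.
pose shell k x := r k / 2 < Delta x <= r k.
have r01 k : 0 < r k <= 1.
  by rewrite /r lt_min ltr01 mulr_gt0 ?exprn_gt0//= ge_min lexx orbT.
have rtau k : tau <= r k.
  by rewrite /r le_min tau1 andbT ler_peMl// ?(ltW tau0)// exprn_ege1// ler1n.
apply: (@le_trans _ _ (\sum_(x <- xs) \sum_(k | shell k x) Delta x `^ (1 - beta))).
  rewrite big_mkcond/=; apply: ler_sum => x _; case: ifPn => hx; last first.
    by apply: sumr_ge0 => k _; exact: powR_ge0.
  have tau01 : 0 < tau <= 1 by rewrite tau0.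
  have hD : tau / 2 < Delta x <= 1 by rewrite hx D1.
  have [k hk] := dyadic_shell tau01 M1 hD.
  rewrite (bigD1 k)//= lerDl; apply: sumr_ge0 => j _; exact: powR_ge0.
rewrite (exchange_big_dep predT)//=.
rewrite mulrAC mulr_natr -[X in _ *+ X]card_ord -sumr_const; apply: ler_sum => k _.
move: (r01 k) => /andP[r0 r1].
pose ys := [seq x <- xs | shell k x].
have hys : all (shell k) ys by exact: filter_all.
apply: (@le_trans _ _ (\sum_(x <- ys) 2 * r k `^ (1 - beta))).
  rewrite big_filter; apply: ler_sum => x /andP[hx _].
  (* The exponent lies in [-1, 0]: the power decreases with the gap, and halving the base at most
     doubles it. *)
  apply: (@le_trans _ _ ((r k / 2) `^ (1 - beta))).
    apply: powR_base_antitone; rewrite ?divr_gt0 ?(ltW hx)//; lra.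
  rewrite powRM ?(ltW r0)// mulrC ler_wpM2r ?powR_ge0//.
  have -> : (2^-1 : RR) = 2 `^ (-1) by rewrite powR_inv1.
  rewrite -powRrM -[leRHS]powRr1//; apply: ler_powR; rewrite ?ler1n//; lra.
rewrite big_const_seq count_predT iter_addr_0 -[_ *+ _]mulr_natl.
apply: (@le_trans _ _ (c * r k `^ (- d) * (2 * r k `^ (1 - beta)))).
  apply: ler_wpM2r; first by rewrite mulr_ge0 ?powR_ge0.
  by apply: (shell_size (r01 k)) => //; exact: pairwise_filter.
have -> : c * r k `^ (- d) * (2 * r k `^ (1 - beta)) =
    2 * c * r k `^ (1 - (d + beta)).
  have -> : r k `^ (1 - (d + beta)) = r k `^ (- d) * r k `^ (1 - beta).
    rewrite -powRD; last by rewrite (gt_eqF r0) implybT.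
    by congr powR; ring.
  by ring.
apply: ler_wpM2l; first by rewrite mulr_ge0// ltW.
(* A nonnegative exponent gives at most 1, as r <= 1; with a negative one the smallest radius, at
   least tau, is the worst. *)
rewrite le_max; have [h|h] := leP 0 (1 - (d + beta)).
  by rewrite powR_le1 ?(ltW r0).
by rewrite (powR_base_antitone tau0 (rtau k) (ltW h)) orbT.
Qed.

End packing.

(** * The algorithm *)

(** With the coefficient 10, [expR (log_budget q)] is at least 2^(10 q), the fifth power of [4 ^ q];
    [init_weight_small] relies on this. *)
Definition log_budget (q : nat) : RR := 10 * q%:R.

(** The observable bound of [sqr_deviation], at a^2 = [log_budget q] and w^2 = [a.2], per play. *)
Definition confidence (q : nat) (a : nat * RR) : RR :=
  (14 * log_budget q + 3 * (Num.sqrt (log_budget q) * Num.sqrt a.2)) / a.1%:R.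

(** One radius for the estimation error and two for the size of the ball: when the radius is valid,
    this bounds [mu z - 1] from above for every z in the ball. *)
Definition arm_index (q : nat) (a : nat * RR) : RR :=
  3 * confidence q a - a.2 / a.1%:R.

Definition best (q : nat) (s : seq (nat * RR)) : nat :=
  find (fun a => all (fun b => arm_index q b <= arm_index q a) s) s.

Definition new_arm : nat * RR := (1%N, 0).

Definition play_arm (r : RR) (a : nat * RR) : nat * RR := (a.1.+1, a.2 + (1 - r)).

(* The clock is 2 plus the number of rounds played.  Phases q = 1, 2, 4, 8, ...
   occupy the clock interval [2 ^ q, 4 ^ q); at each new phase the arms are
   forgotten, so that those of the current phase have the handles base,
   base + 1, ...  The doubly exponential phases make the sum of the log_budget q
   comparable to the last one. *)
Record state := State {
  phase : nat; clock : nat; base : nat; arms : seq (nat * RR); covered : bool }.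

(** A discovery also sets [covered], since the radius of a fresh arm exceeds the diameter of the
    space. *)
Definition step (s : state) (e : event) : state :=
  match e with
  | ECovered => State (phase s) (clock s) (base s) (arms s) true
  | ENew _ => State (phase s) (clock s) (base s) (rcons (arms s) new_arm) true
  | EReward r =>
    let b := best (phase s) (arms s) in
    let arms' := set_nth new_arm (arms s) b (play_arm r (nth new_arm (arms s) b)) in
    if (clock s).+1 == (4 ^ phase s)%N
    then State (2 * phase s) (clock s).+1 (base s + size arms') [::] false
    else State (phase s) (clock s).+1 (base s) arms' false
  end.

Definition init_state := State 1 2 0 [::] false.

Definition run (h : seq event) : state := foldl step init_state h.

Definition confidence_balls (s : state) : seq (nat * RR) :=
  zip (iota (base s) (size (arms s))) [seq 2 * confidence (phase s) a | a <- arms s].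

Definition zooming : algorithm := fun h =>
  let s := run h in
  if covered s then APlay (base s + best (phase s) (arms s))
  else AQuery (confidence_balls s).

Lemma run_rcons (h : seq event) (e : event) : run (rcons h e) = step (run h) e.
Proof. exact: foldl_rcons. Qed.

Lemma log_budget_ge1 (q : nat) : (0 < q)%N -> 1 <= log_budget q.
Proof. by rewrite /log_budget -(ler1n RR); lra. Qed.

Lemma log_budget_ge0 (q : nat) : 0 <= log_budget q.
Proof. exact: mulr_ge0 (ler0n _ _) (ler0n _ _). Qed.

Lemma confidence_ge0 (q : nat) (a : nat * RR) : 0 <= confidence q a.
Proof.
by rewrite divr_ge0// addr_ge0// ?mulr_ge0 ?sqrtr_ge0// mulr_ge0.
Qed.

Lemma confidence_new_arm (q : nat) : (0 < q)%N -> 1 < confidence q new_arm.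
Proof.
move=> /log_budget_ge1 h; rewrite /confidence/= divr1 sqrtr0 mulr0; lra.
Qed.

(** The count at most doubles and the loss does not decrease. A gap of at most 4 radii before a play
    is thus at most 8 radii after it. *)
Lemma confidence_play (q : nat) (a : nat * RR) (r : RR) : (0 < a.1)%N -> 0 <= r <= 1 ->
  confidence q a <= 2 * confidence q (play_arm r a).
Proof.
move=> a0 /andP[r0 r1]; rewrite /confidence/=.
have m0 : 0 < a.1%:R :> RR by rewrite ltr0n.
rewrite ler_pdivrMr// [leRHS]mulrAC [leRHS]mulrCA [leRHS]mulrA ler_pdivlMr// -[a.1.+1%:R]natr1.
have h : Num.sqrt a.2 <= Num.sqrt (a.2 + (1 - r)) by apply: ler_wsqrtr; lra.
have b0 := log_budget_ge0 q.
have s0 := sqrtr_ge0 (log_budget q); have w0 := sqrtr_ge0 a.2.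
have hs : Num.sqrt (log_budget q) * Num.sqrt a.2 <=
          Num.sqrt (log_budget q) * Num.sqrt (a.2 + (1 - r)) by exact: ler_wpM2l.
have p0 : 0 <= Num.sqrt (log_budget q) * Num.sqrt a.2 by exact: mulr_ge0.
have m1 : 1 <= a.1%:R :> RR by rewrite ler1n.
set x := Num.sqrt (log_budget q) * Num.sqrt a.2 in p0 hs *.
set y := Num.sqrt (log_budget q) * Num.sqrt (a.2 + (1 - r)) in hs *.
apply: (@le_trans _ _ ((14 * log_budget q + 3 * x) * (2 * a.1%:R))).
  by apply: ler_wpM2l; lra.
have : x * a.1%:R <= y * a.1%:R by apply: ler_wpM2r => //; lra.
lra.
Qed.

Lemma best_max (q : nat) (s : seq (nat * RR)) : (0 < size s)%N ->
  (best q s < size s)%N /\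
  forall j, (j < size s)%N ->
    arm_index q (nth new_arm s j) <= arm_index q (nth new_arm s (best q s)).
Proof.
move=> s0; have : has (fun a => all (fun b => arm_index q b <= arm_index q a) s) s.
  elim: s s0 => // a s IH _ /=.
  have [->|s0] := eqVneq s [::]; first by rewrite /= lexx.
  have {IH} := IH _; rewrite lt0n size_eq0 => /(_ s0) /hasP[b bs bmax].
  have [ab|ba] := leP (arm_index q a) (arm_index q b).
    by apply/orP; right; apply/hasP; exists b => //=; rewrite ab.
  rewrite lexx/=; apply/orP; left; apply/allP => x /(allP bmax) h.
  exact: le_trans (ltW ba).
move=> hs; split; first by rewrite -has_find.
by move=> j js; have /allP := nth_find new_arm hs; apply; exact: mem_nth.
Qed.

(** Resolves the handles of a query to the points of the current phase; the induction moves the head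
    of [xs] to the end of [old]. *)
Lemma pmap_onth_iota (T : Type) (old xs : seq T) (rs : seq RR) :
  size xs = size rs ->
  pmap (fun b => omap (fun x => (x, b.2)) (onth (old ++ xs) b.1))
    (zip (iota (size old) (size rs)) rs) = zip xs rs.
Proof.
elim: rs old xs => [|r rs IH] old [|x xs]//= [sz].
rewrite onth_cat ltnn subnn/=; congr cons.
by rewrite -cat_rcons -(size_rcons old x) IH.
Qed.

(** * Interaction with the oracle in one round *)

Section rounds.
Context {X : Type} (L : X -> X -> RR) (O : seq (X * RR) -> option X).
Context (P : X -> probability RR RR) (x0 : X).
Hypothesis L_le1 : forall x y, L x y <= 1.
Hypothesis oracle : covering_oracle L O.

Definition open_query (h : seq event) (old xs : seq X) : Prop :=
  [/\ covered (run h) = false, size old = base (run h) &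
      size xs = size (arms (run h))].

Definition same_phase (s s' : state) : Prop :=
  [/\ phase s' = phase s, clock s' = clock s & base s' = base s].

Definition extends (q : nat) (xs xs' : seq X) (s s' : seq (nat * RR)) : Prop :=
  (xs' = xs /\ s' = s) \/
  exists y, [/\ xs' = rcons xs y, s' = rcons s new_arm &
    forall i, (i < size s)%N -> 2 * confidence q (nth new_arm s i) <= L (nth x0 xs i) y].

Definition covers (q : nat) (xs : seq X) (s : seq (nat * RR)) : Prop :=
  forall z, exists2 i, (i < size s)%N &
    L (nth x0 xs i) z < 2 * confidence q (nth new_arm s i).

Lemma payoff_query (A : algorithm) (n t : nat) (h : seq event) (pts : seq X) bs :
  A h = AQuery bs -> payoff_fuel L O P A n.+1 t.+1 h pts =
  match O (pmap (fun b => omap (fun x => (x, b.2)) (onth pts b.1)) bs) with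
  | None => payoff_fuel L O P A n t.+1 (rcons h ECovered) pts
  | Some y => payoff_fuel L O P A n t.+1
                (rcons h (ENew [seq L p y | p <- pts])) (rcons pts y)
  end.
Proof. by move=> /= ->. Qed.

(* A round consists of one covering query, which may reveal a new arm whose
   ball then covers everything, followed by one play. *)
Lemma round_payoff (n t : nat) (h : seq event) (old xs : seq X) :
  (0 < phase (run h))%N -> open_query h old xs ->
  exists h' xs',
    [/\ same_phase (run h) (run h'),
        size xs' = size (arms (run h')),
        extends (phase (run h)) xs xs' (arms (run h)) (arms (run h')),
        covers (phase (run h)) xs' (arms (run h')) &
        payoff_fuel L O P zooming n.+2 t.+1 h (old ++ xs) =
        (\int[P (nth x0 xs' (best (phase (run h')) (arms (run h'))))]_(r in `[0%R, 1%R])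
          (r%:E + payoff_fuel L O P zooming n t (rcons h' (EReward r)) (old ++ xs')))%E].
Proof.
move=> q0 [cov szo szx]; set s := run h in q0 cov szo szx *.
have play h' xs' : covered (run h') = true -> base (run h') = size old ->
    size xs' = size (arms (run h')) -> (0 < size xs')%N ->
    payoff_fuel L O P zooming n.+1 t.+1 h' (old ++ xs') =
    (\int[P (nth x0 xs' (best (phase (run h')) (arms (run h'))))]_(r in `[0%R, 1%R])
      (r%:E + payoff_fuel L O P zooming n t (rcons h' (EReward r)) (old ++ xs')))%E.
  move=> c' b' sz' sz0; rewrite /= {1}/zooming c' b'.
  have s0 : (0 < size (arms (run h')))%N by rewrite -sz'.
  have [blt _] := best_max (phase (run h')) s0.
  by rewrite onth_cat ltnNge leq_addr/= addKn onthE (nth_map x0) ?sz'.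
have balls : pmap (fun b => omap (fun x => (x, b.2)) (onth (old ++ xs) b.1))
    (confidence_balls s) = zip xs [seq 2 * confidence (phase s) a | a <- arms s].
  rewrite /confidence_balls -szo -(size_map (fun a => 2 * confidence (phase s) a)).
  by apply: pmap_onth_iota; rewrite size_map.
have hasE z : has (fun b => L b.1 z < b.2)
    (zip xs [seq 2 * confidence (phase s) a | a <- arms s]) ->
    exists2 i, (i < size (arms s))%N &
      L (nth x0 xs i) z < 2 * confidence (phase s) (nth new_arm (arms s) i).
  move=> /(has_nthP (x0, 0))[i]; rewrite size_zip size_map szx minnn => ilt.
  rewrite nth_zip ?size_map//= (nth_map new_arm)// => hi.
  by exists i.
have query : zooming h = AQuery (confidence_balls s) by rewrite /zooming -/s cov.
have := oracle (zip xs [seq 2 * confidence (phase s) a | a <- arms s]).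
case Oy: (O _) => [y|] hO.
- pose h' := rcons h (ENew [seq L p y | p <- old ++ xs]).
  have runh' : run h' = State (phase s) (clock s) (base s) (rcons (arms s) new_arm) true.
    by rewrite /h' run_rcons.
  have sz' : size (rcons xs y) = size (arms (run h')) by rewrite runh'/= !size_rcons szx.
  exists h', (rcons xs y); split => //.
  + by rewrite runh'.
  + right; exists y; rewrite runh'; split=> // i ilt.
    rewrite leNgt; apply/negP => hi; apply: hO; apply/(has_nthP (x0, 0)).
    exists i; first by rewrite size_zip size_map szx minnn.
    by rewrite nth_zip ?size_map//= (nth_map new_arm).
  + move=> z; exists (size (arms s)); first by rewrite runh' size_rcons.
    rewrite runh'/= !nth_rcons szx ltnn eqxx.
    apply: le_lt_trans (L_le1 _ _) _; have := confidence_new_arm q0; lra.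
  + rewrite (payoff_query _ _ _ query) balls Oy rcons_cat -/h'.
    by rewrite play ?runh' ?size_rcons ?szo// szx.
- pose h' := rcons h ECovered.
  have runh' : run h' = State (phase s) (clock s) (base s) (arms s) true.
    by rewrite /h' run_rcons.
  (* Coverage of [x0] exhibits an arm, so that the best arm exists. *)
  have szx0 : (0 < size xs)%N.
    by have [i ilt _] := hasE x0 (hO x0); rewrite szx; exact: leq_ltn_trans ilt.
  exists h', xs; split; rewrite ?runh'//.
  + by left.
  + by move=> z; exact: hasE.
  + rewrite (payoff_query _ _ _ query) balls Oy -/h'.
    by rewrite play ?runh'.
Qed.

Lemma payoff_ge0 (A : algorithm) (n t : nat) (h : seq event) (pts : seq X) :
  (0 <= payoff_fuel L O P A n t h pts)%E.
Proof.
elim: n t h pts => [|n IH] [|t] h pts //=.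
case: (A h) => [bs|i]; first by case: (O _) => [y|]; exact: IH.
case: (onth pts i) => [x|//]; apply: integral_ge0 => r /=.
by rewrite in_itv/= => /andP[r0 _]; rewrite adde_ge0// lee_fin.
Qed.

End rounds.

Section instances.
Context {X : Type} (L : X -> X -> RR) (mu : X -> RR) (P : X -> probability RR RR).
Hypothesis inst : instance L mu P.

Lemma mu_unit_interval (x : X) : 0 <= mu x <= 1.
Proof.
case: inst => _ [P1 Pmu].
by apply: (@mean_full_set _ _ _ (P x) `[0%R, 1%R]%classic id).
Qed.

(** One step of the backward induction: [b * (r - mu x)] has mean 0 and absorbs the change of the
    potential. *)
Lemma reward_integral_ge (x : X) (v b : RR) (f : RR -> \bar RR) :
  (forall r : RR, 0 <= f r)%E ->
  (forall r : RR, 0 <= r <= 1 -> ((v + b * (r - mu x))%:E <= f r)%E) ->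
  ((mu x + v)%:E <= \int[P x]_(r in `[0%R, 1%R]) (r%:E + f r))%E.
Proof.
case: inst => _ [P1 Pmu] f0 fv.
have -> : mu x + v = v - b * mu x + (1 + b) * mu x by ring.
apply: (@integral_ge_affine _ _ _ (P x) `[0%R, 1%R]%classic id) => //=.
- by move=> r; rewrite in_itv/= => /andP[r0 _]; rewrite adde_ge0// lee_fin.
- move=> r; rewrite in_itv/= => r01.
  have -> : v - b * mu x + (1 + b) * r = r + (v + b * (r - mu x)) by ring.
  by rewrite EFinD leeD2l// fv.
Qed.

Lemma mu_le_mustar (x : X) : mu x <= mustar mu.
Proof.
apply: ub_le_sup; last by exists x.
by exists 1 => _ [y _ <-]; case/andP: (mu_unit_interval y).
Qed.

Lemma mustar_le1 (x : X) : mustar mu <= 1.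
Proof.
apply: ge_sup; first by exists (mu x), x.
by move=> _ [y _ <-]; case/andP: (mu_unit_interval y).
Qed.

Lemma gap_unit_interval (x : X) : 0 <= gap mu x <= 1.
Proof.
rewrite subr_ge0 mu_le_mustar /gap.
have := mustar_le1 x; have /andP[] := mu_unit_interval x; lra.
Qed.

End instances.

(** * Plays of an arm *)

Section arm_sums.
Context {X : Type} (x0 : X).
Implicit Types (F : X -> nat * RR -> RR) (xs : seq X) (s : seq (nat * RR)).

Definition arm_sum F xs s : RR :=
  \sum_(0 <= i < size s) F (nth x0 xs i) (nth new_arm s i).

Lemma arm_sum_rcons F xs s y a : size xs = size s ->
  arm_sum F (rcons xs y) (rcons s a) = arm_sum F xs s + F y a.
Proof.
move=> sz; rewrite /arm_sum size_rcons big_nat_recr//= !nth_rcons sz ltnn eqxx.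
congr (_ + _); apply: eq_big_nat => i /andP[_ ilt].
by rewrite !nth_rcons sz ilt.
Qed.

Lemma arm_sum_set_nth F xs s b v : (b < size s)%N ->
  arm_sum F xs (set_nth new_arm s b v) =
  arm_sum F xs s - F (nth x0 xs b) (nth new_arm s b) + F (nth x0 xs b) v.
Proof.
move=> blt; rewrite /arm_sum size_set_nth (maxn_idPr blt) !big_mkord.
rewrite (bigD1 (Ordinal blt))//= [in RHS](bigD1 (Ordinal blt))//= nth_set_nth/= eqxx.
rewrite (eq_bigr (fun i : 'I_(size s) => F (nth x0 xs i) (nth new_arm s i))).
  by rewrite addrC; congr (_ + _); rewrite addrAC subrr add0r.
by move=> i ib; rewrite nth_set_nth/=; case: eqP => // eib; move: ib; rewrite -val_eqE/= eib eqxx.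
Qed.

Lemma ler_arm_sum F F' xs s s' : size s = size s' ->
  (forall i, (i < size s)%N ->
    F (nth x0 xs i) (nth new_arm s i) <= F' (nth x0 xs i) (nth new_arm s' i)) ->
  arm_sum F xs s <= arm_sum F' xs s'.
Proof. by move=> sz h; rewrite /arm_sum -sz; apply: ler_sum_nat => i /andP[_]; exact: h. Qed.

Lemma arm_sum_ge_term F xs s i : (forall x a, 0 <= F x a) -> (i < size s)%N ->
  F (nth x0 xs i) (nth new_arm s i) <= arm_sum F xs s.
Proof.
move=> F0 ilt; rewrite /arm_sum big_mkord (bigD1 (Ordinal ilt))//= lerDl.
by apply: sumr_ge0 => j _.
Qed.

End arm_sums.

(** The bound of [potential_init] for a grid long enough for every count up to [4 ^ q]. *)
Definition init_weight (q : nat) : RR := (4 ^ q).+1%:R * (4 * expR (- log_budget q)).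

Lemma init_weight_ge0 q : 0 <= init_weight q.
Proof. by rewrite !mulr_ge0 ?expR_ge0. Qed.

(** One factor [4 ^ q] bounds the number of arms discovered in a phase, the other the rounds lost
    upon failure: failures cost at most 1 per phase. *)
Lemma init_weight_small q : (0 < q)%N ->
  (4 ^ q)%:R * ((4 ^ q)%:R * init_weight q) <= 1 :> RR.
Proof.
move=> q0; rewrite /init_weight.
have T4 : 4 <= (4 ^ q)%:R :> RR by rewrite ler_nat -[X in (X <= _)%N]expn1 leq_exp2l.
have T5 : (4 ^ q)%:R ^+ 5 <= expR (log_budget q) :> RR.
  rewrite /log_budget -natrM -natrX; apply: le_trans (exp2_le_expR _).
  by rewrite ler_nat -expnM -[4%N]/(2 ^ 2)%N -expnM leq_exp2l//; lia.
rewrite -natr1; move: T4 T5; set T := (4 ^ q)%:R => T4 T5.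
rewrite expRN; set e := expR _ in T5 *.
have e0 : 0 < e by exact: expR_gt0.
have -> : T * (T * ((T + 1) * (4 * e^-1))) = T * T * (T + 1) * 4 / e by ring.
rewrite ler_pdivrMr// mul1r; apply: le_trans T5.
have -> : T ^+ 5 = T * T * (T ^+ 3) by ring.
have -> : T * T * (T + 1) * 4 = T * T * ((T + 1) * 4) by ring.
apply: ler_wpM2l; first by rewrite mulr_ge0//; lra.
have : 16 <= T ^+ 2 by nra.
have -> : T ^+ 3 = T * T ^+ 2 by ring.
nra.
Qed.

(** * Confidence intervals and the regret of each arm *)

Section pathwise.
Context {X : Type} (L : X -> X -> RR) (mu : X -> RR) (P : X -> probability RR RR).
Context (x0 : X) (beta : RR).
Hypothesis inst : instance L mu P.
Hypothesis betaE : beta = 2 \/ (mustar mu = 1 /\ beta = 1).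
Local Notation Delta := (gap mu).
Local Notation asum := (arm_sum x0).

Definition arm_potential q (x : X) a : RR :=
  potential (4 ^ q).+1 (log_budget q) (1 - mu x) a.

Lemma loss_unit_interval x : 0 <= 1 - mu x <= 1.
Proof. have /andP[] := mu_unit_interval inst x; lra. Qed.

(** [potential_deviation] followed by [sqr_deviation], with u and w the square roots of m (1 - mu x)
    and of the cumulative loss. *)
Lemma confidence_valid q x (a : nat * RR) : (0 < q)%N -> (0 < a.1 <= 4 ^ q)%N -> 0 <= a.2 ->
  arm_potential q x a < 1 ->
  `|a.2 / a.1%:R - (1 - mu x)| <= confidence q a /\
  a.1%:R * confidence q a <= 20 * log_budget q +
    3 * (Num.sqrt (log_budget q) * Num.sqrt (a.1%:R * (1 - mu x))).
Proof.
move=> q0 a1 a2 hp; have A1 := log_budget_ge1 q0; have n01 := loss_unit_interval x.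
have m0 : 0 < a.1%:R :> RR by rewrite ltr0n; case/andP: a1.
have dev := @potential_deviation _ (4 ^ q).+1 _ _ a A1 n01 a1 hp.
have s0 : 0 < Num.sqrt (log_budget q) by rewrite sqrtr_gt0; lra.
have := @sqr_deviation _ _ _ _ s0 (sqrtr_ge0 (a.1%:R * (1 - mu x))) (sqrtr_ge0 a.2).
have p0 : 0 <= a.1%:R * (1 - mu x) by rewrite mulr_ge0//; case/andP: n01.
have A0 : 0 <= log_budget q by lra.
rewrite !sqr_sqrtr// => /(_ dev)[h1 h2].
have e : a.1%:R * confidence q a =
    14 * log_budget q + 3 * (Num.sqrt (log_budget q) * Num.sqrt a.2).
  by rewrite /confidence mulrC divfK// gt_eqF.
split; last by rewrite e.
rewrite -(ler_pM2l m0) e -[X in X * `|_|]gtr0_norm// -normrM mulrBr.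
by rewrite [a.1%:R * (_ / _)]mulrC divfK// gt_eqF.
Qed.

(** Eight radii give m Delta <= 160 A + 24 sqrt (A m (1 - mu x)). For beta = 2, bound 1 - mu x by 1
    and solve for z = sqrt m * Delta; for beta = 1, 1 - mu x is Delta itself and z = sqrt (m
    Delta). *)
Lemma arm_regret q x (a : nat * RR) : (0 < q)%N -> (0 < a.1 <= 4 ^ q)%N -> 0 <= a.2 ->
  arm_potential q x a < 1 -> Delta x <= 8 * confidence q a -> 0 < Delta x ->
  Delta x * a.1%:R <= 900 * log_budget q * Delta x `^ (1 - beta).
Proof.
move=> q0 a1 a2 hp hD D0; have [_ hc] := confidence_valid q0 a1 a2 hp.
have m1 : 1 <= a.1%:R :> RR by rewrite ler1n; case/andP: a1.
have A0 := log_budget_ge0 q.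
have sA : Num.sqrt (log_budget q) ^+ 2 = log_budget q by rewrite sqr_sqrtr.
have s0 := sqrtr_ge0 (log_budget q).
have h : Delta x * a.1%:R <= 160 * Num.sqrt (log_budget q) ^+ 2 +
    24 * (Num.sqrt (log_budget q) * Num.sqrt (a.1%:R * (1 - mu x))).
  have : Delta x * a.1%:R <= 8 * confidence q a * a.1%:R by rewrite ler_wpM2r//; lra.
  rewrite sA; lra.
have /andP[_ D1] := gap_unit_interval inst x.
have [bE|[m1E bE]] := betaE; rewrite bE.
- have z0 : 0 <= Num.sqrt a.1%:R * Delta x by rewrite mulr_ge0 ?sqrtr_ge0// ltW.
  have zE : (Num.sqrt a.1%:R * Delta x) ^+ 2 = Delta x * a.1%:R * Delta x.
    by rewrite exprMn sqr_sqrtr; [ring | lra].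
  have := quadratic_bound s0 z0; rewrite zE sA => /(_ _) hq.
  have -> : 1 - 2 = -1 :> RR by ring.
  rewrite powR_inv1 ?(ltW D0)// ler_pdivlMr//; apply: hq.
  have w : Num.sqrt (a.1%:R * (1 - mu x)) <= Num.sqrt a.1%:R.
    apply: ler_wsqrtr; rewrite -[leRHS]mulr1 ler_wpM2l//.
    by case/andP: (loss_unit_interval x).
  have w0 := sqrtr_ge0 (a.1%:R * (1 - mu x)).
  have hw : Num.sqrt (log_budget q) * Num.sqrt (a.1%:R * (1 - mu x)) <=
            Num.sqrt (log_budget q) * Num.sqrt a.1%:R by rewrite ler_wpM2l.
  apply: (@le_trans _ _ ((160 * log_budget q + 24 * (Num.sqrt (log_budget q) * Num.sqrt a.1%:R)) * Delta x)).
    apply: ler_wpM2r; [exact: ltW | rewrite -{1}sA; lra].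
  nra.
- have nE : 1 - mu x = Delta x by rewrite /gap m1E.
  have p0 : 0 <= a.1%:R * Delta x by rewrite mulr_ge0// ltW.
  have -> : 1 - 1 = 0 :> RR by ring.
  rewrite powRr0 mulr1 -{1}sA mulrC.
  have := quadratic_bound s0 (sqrtr_ge0 (a.1%:R * Delta x)).
  rewrite (sqr_sqrtr p0) sA; apply; rewrite sA nE in h.
  by rewrite [leLHS]mulrC; exact: h.
Qed.

Definition good_arms q (clk : nat) xs s : Prop :=
  [/\ gap_separated L mu xs,
      forall i, (i < size s)%N ->
        let a := nth new_arm s i in
        [/\ (0 < a.1)%N, 0 <= a.2 & Delta (nth x0 xs i) <= 8 * confidence q a] &
      asum (fun _ a => a.1%:R - 1) xs s <= clk%:R].

(** The second term is a reserve for arms yet to come: each remaining round of the phase discovers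
    at most one. *)
Definition failure_potential q (clk : nat) xs s : RR :=
  asum (arm_potential q) xs s + ((4 ^ q)%:R - clk%:R) * init_weight q.

Lemma arm_count q clk xs s i : good_arms q clk xs s -> (clk < 4 ^ q)%N ->
  (i < size s)%N -> ((nth new_arm s i).1 <= 4 ^ q)%N.
Proof.
move=> [_ h hs] clkq ilt; rewrite -(ler_nat RR).
have hF : (nth new_arm s i).1%:R - 1 <= asum (fun _ a => a.1%:R - 1) xs s.
  rewrite /arm_sum big_mkord (bigD1 (Ordinal ilt))//= lerDl.
  by apply: sumr_ge0 => j _; have [] := h j (ltn_ord j); rewrite subr_ge0 ler1n.
have : clk.+1%:R <= (4 ^ q)%:R :> RR by rewrite ler_nat.
rewrite -natr1; lra.
Qed.

Lemma arm_potential_lt1 q xs s i : asum (arm_potential q) xs s < 1 -> (i < size s)%N ->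
  arm_potential q (nth x0 xs i) (nth new_arm s i) < 1.
Proof.
move=> h ilt; apply: le_lt_trans h; apply: arm_sum_ge_term => // x a.
exact: potential_ge0.
Qed.

(** As [a.1] is one more than the number of plays, this also accounts for a play about to be
    made. *)
Definition large_gap_regret delta x (a : nat * RR) : RR :=
  if delta < Delta x then Delta x * a.1%:R else 0.

Lemma large_gap_regret_sum q clk xs s delta B : (0 < q)%N -> (clk < 4 ^ q)%N ->
  0 <= delta -> size xs = size s -> good_arms q clk xs s ->
  asum (arm_potential q) xs s < 1 ->
  9000 * (\sum_(x <- xs | delta < Delta x) Delta x `^ (1 - beta)) <= B ->
  asum (large_gap_regret delta) xs s <= B * q%:R.
Proof.
move=> q0 clkq d0 sz good pot hB.
apply: le_trans (ler_wpM2r (ler0n _ _) hB).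
(* 9000 is the 900 of [arm_regret] times the 10 of [log_budget]. *)
have -> (y : RR) : 9000 * y * q%:R = 900 * log_budget q * y by rewrite /log_budget; ring.
rewrite (big_nth x0) big_mkcond/= sz mulr_sumr /arm_sum.
apply: ler_sum_nat => i /andP[_ ilt]; rewrite /large_gap_regret.
case: ifPn => hd; last by rewrite mulr0.
have [_ /(_ i ilt)[ha1 ha2 haD] _] := good.
apply: arm_regret => //; last exact: le_lt_trans hd.
  by rewrite ha1 (arm_count good).
exact: arm_potential_lt1.
Qed.

End pathwise.

(** * Regret *)

(* [lra] compares atoms up to conversion, which would unfold the algorithm. *)
Ltac atom t := let x := fresh "x" in generalize t; intro x.

Ltac opaque_lra :=
  repeat match goal with
  | |- context [failure_potential ?a ?b ?c ?d ?e ?f] => atom (failure_potential a b c d e f)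
  | |- context [arm_sum ?a ?b ?c ?d] => atom (arm_sum a b c d)
  | |- context [init_weight ?a] => atom (init_weight a)
  | |- context [gap ?a ?b] => atom (gap a b)
  | |- context [mustar ?a] => atom (mustar a)
  | |- context [expn ?a ?b] => atom (expn a b)
  | |- context [clock ?a] => atom (clock a)
  | |- context [phase ?a] => atom (phase a)
  end;
  repeat match goal with
  | H : context [run _] |- _ => clear H
  | H : context [arm_sum] |- _ => clear H
  | H : context [failure_potential] |- _ => clear H
  | H : context [init_weight] |- _ => clear H
  | H : context [confidence] |- _ => clear H
  end; move=> *; lra.

(** * The invariant under a query and a play *)

Section arm_invariant.
Context {X : Type} (L : X -> X -> RR) (mu : X -> RR) (P : X -> probability RR RR).
Context (x0 : X).
Hypothesis inst : instance L mu P.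
Local Notation Delta := (gap mu).
Local Notation asum := (arm_sum x0).

(** Regret beyond an allowance of [delta] per play; arms with a smaller gap contribute nonpositive
    terms. *)
Definition excess delta x (a : nat * RR) : RR := (Delta x - delta) * (a.1%:R - 1).

(** A new point is 2 radii away from each arm, whose gap is at most 8 radii, hence the separation by
    a quarter gap. It has no plays yet, and a radius above 1 bounds its own gap. *)
Lemma good_arms_extends q clk xs xs' s s' delta : (0 < q)%N -> size xs = size s ->
  good_arms L mu x0 q clk xs s -> extends L x0 q xs xs' s s' ->
  [/\ good_arms L mu x0 q clk xs' s',
      asum (excess delta) xs' s' = asum (excess delta) xs s &
      asum (arm_potential mu q) xs' s' <= asum (arm_potential mu q) xs s + init_weight q].
Proof.
move=> q0 sz good; case=> [[-> ->]|[y [-> -> sep]]].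
  by split => //; rewrite lerDl init_weight_ge0.
have [gsep garms gsum] := good.
split; last 2 first.
- by rewrite arm_sum_rcons// /excess/= subrr mulr0 addr0.
- rewrite arm_sum_rcons// lerD2l; apply: potential_init.
  exact: loss_unit_interval inst y.
split.
- rewrite /gap_separated pairwise_rcons; apply/andP; split => //.
  apply/(all_nthP x0) => i; rewrite sz => ilt.
  by have := sep i ilt; have [_ _] := garms i ilt; lra.
- move=> i; rewrite size_rcons ltnS leq_eqVlt => /orP[/eqP ->|ilt].
    rewrite !nth_rcons sz ltnn eqxx/=; split => //.
    have /andP[_] := gap_unit_interval inst y; have := confidence_new_arm q0; lra.
  by rewrite !nth_rcons sz ilt; exact: garms.
- by rewrite arm_sum_rcons//= subrr addr0.
Qed.

(* Any near-optimal point z lies in a confidence ball, and the index of its arm,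
   hence that of the best arm, is at least mu z - 1. *)
Lemma best_gap q clk xs s : (0 < q)%N -> (clk < 4 ^ q)%N -> (0 < size s)%N ->
  good_arms L mu x0 q clk xs s -> asum (arm_potential mu q) xs s < 1 ->
  covers L x0 q xs s ->
  Delta (nth x0 xs (best q s)) <= 4 * confidence q (nth new_arm s (best q s)).
Proof.
move=> q0 clkq s0 good pot cov; rewrite leNgt; apply/negP => hlt.
have [blt bmax] := best_max q s0.
have acc i : (i < size s)%N ->
    `|(nth new_arm s i).2 / (nth new_arm s i).1%:R - (1 - mu (nth x0 xs i))| <=
    confidence q (nth new_arm s i).
  move=> ilt; have [_ /(_ i ilt)[h1 h2 _] _] := good.
  have hc := arm_count good clkq ilt.
  have [] // := @confidence_valid _ _ _ _ inst q (nth x0 xs i) (nth new_arm s i) q0 _ h2.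
    by rewrite h1.
  exact: arm_potential_lt1.
(* The supremum may not be attained; the assumed excess of the gap over 4 radii is the slack that
   yields z. *)
have [z hz] : exists z, mustar mu - (Delta (nth x0 xs (best q s)) -
    4 * confidence q (nth new_arm s (best q s))) < mu z.
  have := @sup_gt _ (range mu) (mustar mu - (Delta (nth x0 xs (best q s)) -
    4 * confidence q (nth new_arm s (best q s)))).
  case; [by exists (mu x0), x0| by rewrite -/(mustar mu); lra|].
  by move=> _ [z _ <-] h; exists z.
have [i ilt hi] := cov z.
have := bmax i ilt; rewrite /arm_index.
have := acc i ilt; have := acc _ blt; rewrite !ler_norml => /andP[h1 h2] /andP[h3 h4].
have [lip _] := inst.
have := lip (nth x0 xs i) z; rewrite ler_norml => /andP[h5 h6].
move: hz; rewrite /gap; lra.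
Qed.

Lemma good_arms_play q clk xs s b r : (b < size s)%N -> 0 <= r <= 1 ->
  good_arms L mu x0 q clk xs s ->
  Delta (nth x0 xs b) <= 4 * confidence q (nth new_arm s b) ->
  good_arms L mu x0 q clk.+1 xs (set_nth new_arm s b (play_arm r (nth new_arm s b))).
Proof.
move=> blt r01 [gsep garms gsum] hb; split => //.
- move=> i; rewrite size_set_nth (maxn_idPr blt) => ilt.
  rewrite nth_set_nth/=; case: eqP => [->|_]; last exact: garms.
  have [h1 h2 _] := garms b blt; split => //=.
    by move: r01 => /andP[]; lra.
  have := confidence_play q h1 r01; lra.
- rewrite arm_sum_set_nth//= -!natr1; lra.
Qed.

Lemma excess_le_large_gap_regret delta x (a a' : nat * RR) : 0 <= delta ->
  (0 < a'.1)%N -> (a'.1 <= a.1.+1)%N -> excess delta x a' <= large_gap_regret mu delta x a.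
Proof.
move=> d0; rewrite -(ler1n RR) -(ler_nat RR) -natr1 /excess /large_gap_regret => h1 h2.
have /andP[D0 D1] := gap_unit_interval inst x.
by case: ifPn => [hd|]; rewrite -?leNgt; nra.
Qed.

End arm_invariant.

(** * Backward induction on the remaining rounds *)

Section regret_induction.
Context {X : Type} (L : X -> X -> RR) (mu : X -> RR) (P : X -> probability RR RR).
Context (O : seq (X * RR) -> option X) (x0 : X).
Hypothesis L_le1 : forall x y, L x y <= 1.
Hypothesis oracle : covering_oracle L O.
Hypothesis inst : instance L mu P.
Local Notation Delta := (gap mu).
Local Notation asum := (arm_sum x0).
Local Notation payoff := (payoff_fuel L O P zooming).

(** Every arm played earns at least [mustar mu - D] on average; the fuel [2 * t] allows a query and
    a play per round. *)
Lemma payoff_uniform_gap (D : RR) (t : nat) (h : seq event) (old xs : seq X) :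
  (forall x, Delta x <= D) -> (0 < phase (run h))%N -> open_query h old xs ->
  ((t%:R * (mustar mu - D))%:E <= payoff (2 * t) t h (old ++ xs))%E.
Proof.
move=> hD; elim: t h old xs => [|t IH] h old xs q0 wf.
  by rewrite mul0r; exact: payoff_ge0.
have -> : (2 * t.+1)%N = (2 * t).+2 by rewrite mulnS.
have [h' [xs' [[ph _ ba] sz' _ cov ->]]] :=
  round_payoff P x0 L_le1 oracle (2 * t) t q0 wf.
set x := nth x0 xs' _.
apply: (@le_trans _ _ (mu x + t%:R * (mustar mu - D))%:E).
  rewrite lee_fin -natr1; have := hD x; rewrite /gap; lra.
apply: (@reward_integral_ge _ _ _ _ inst _ _ 0); first by move=> r; exact: payoff_ge0.
move=> r r01; rewrite mul0r addr0.
have [i0 ilt _] := cov x0.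
have s0 : (0 < size (arms (run h')))%N by exact: leq_ltn_trans ilt.
have [blt _] := best_max (phase (run h')) s0.
have [_ szo _] := wf.
pose s' := set_nth new_arm (arms (run h')) (best (phase (run h')) (arms (run h')))
  (play_arm r (nth new_arm (arms (run h')) (best (phase (run h')) (arms (run h'))))).
have szs' : size s' = size (arms (run h')) by rewrite size_set_nth (maxn_idPr blt).
have runE : run (rcons h' (EReward r)) =
  if (clock (run h')).+1 == (4 ^ phase (run h'))%N
  then State (2 * phase (run h')) (clock (run h')).+1 (base (run h') + size s') [::] false
  else State (phase (run h')) (clock (run h')).+1 (base (run h')) s' false.
  by rewrite run_rcons.
case: ifP runE => _ runE.
  (* At a phase change all points found so far become old. *)
  rewrite -[_ ++ _]cats0; apply: IH; rewrite /open_query runE/= ?ph ?muln_gt0 ?q0//.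
  by rewrite size_cat szo ba szs' sz'.
by apply: IH; rewrite /open_query runE/= ?ph// szs' ba.
Qed.

Context (beta delta B Q : RR) (T : nat).
Hypothesis betaE : beta = 2 \/ (mustar mu = 1 /\ beta = 1).
Hypothesis delta_ge0 : 0 <= delta.
Hypothesis B_ge0 : 0 <= B.
Hypothesis packing : forall xs, gap_separated L mu xs ->
  9000 * (\sum_(x <- xs | delta < Delta x) Delta x `^ (1 - beta)) <= B.
Hypothesis horizon : forall q, (2 ^ q <= T + 2)%N -> 2 * q%:R <= Q.

(** A phase q' costs (B + 1) q'. The phases after q are 2 q, 4 q, and so on up to some p with 2 p <=
    Q, and they sum to 2 p - 2 q. *)
Definition later_phases (q : nat) : RR := (B + 1) * (Q - 2 * q%:R).

Definition well_formed (t : nat) (h : seq event) (old xs : seq X) : Prop :=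
  [/\ open_query h old xs, (0 < phase (run h))%N,
      (2 ^ phase (run h) <= clock (run h) < 4 ^ phase (run h))%N &
      (clock (run h) + t = T + 2)%N].

Lemma later_phases_ge0 t h old xs : well_formed t h old xs ->
  0 <= later_phases (phase (run h)).
Proof.
move=> [_ _ /andP[h1 _] h2]; apply: mulr_ge0.
  exact: addr_ge0 B_ge0 ler01.
rewrite subr_ge0; apply: horizon; apply: leq_trans h1 _.
by rewrite -h2 leq_addr.
Qed.

(* Valid in every state: the remaining rounds of the phase may be lost. *)
Definition phase_bound (t : nat) (s : state) : RR :=
  t%:R * (mustar mu - delta) - ((4 ^ phase s)%:R - (clock s)%:R) -
  later_phases (phase s).

(* Valid while the invariant holds; the failure of the confidence intervals, at
   cost 4 ^ q, is paid for by the potential, a supermartingale. *)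
Definition good_bound (t : nat) (s : state) (xs : seq X) : RR :=
  t%:R * (mustar mu - delta) -
  (B * (phase s)%:R - asum (excess mu delta) xs (arms s)) -
  (4 ^ phase s)%:R * failure_potential mu x0 (phase s) (clock s) xs (arms s) -
  later_phases (phase s).

(** A potential of at least 1 charges the full [4 ^ q], while the excess gains back at most the
    clock, gaps being at most 1. *)
Lemma good_bound_failed t h old xs : well_formed t h old xs ->
  good_arms L mu x0 (phase (run h)) (clock (run h)) xs (arms (run h)) ->
  1 <= failure_potential mu x0 (phase (run h)) (clock (run h)) xs (arms (run h)) ->
  good_bound t (run h) xs <= phase_bound t (run h).
Proof.
move=> wf [_ garms gsum] fail; rewrite /good_bound /phase_bound.
have S : asum (excess mu delta) xs (arms (run h)) <= (clock (run h))%:R.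
  apply: le_trans gsum; apply: ler_arm_sum => // i ilt; have [h1 _ _] := garms i ilt.
  have /andP[D0 D1] := gap_unit_interval inst (nth x0 xs i).
  rewrite /excess ler_piMl ?subr_ge0 ?ler1n//; have := delta_ge0; lra.
have p0 : 0 <= B * (phase (run h))%:R.
  exact: mulr_ge0 B_ge0 (ler0n _ _).
have : (4 ^ phase (run h))%:R <= (4 ^ phase (run h))%:R *
    failure_potential mu x0 (phase (run h)) (clock (run h)) xs (arms (run h)).
  by rewrite ler_peMr.
move: S p0; opaque_lra.
Qed.

(** Without arms the failure term is only the reserve, whose cost is at most 1 by
    [init_weight_small], hence at most the phase number. *)
Lemma good_bound_new_phase t s : (0 < phase s)%N -> arms s = [::] ->
  t%:R * (mustar mu - delta) - (B + 1) * (Q - (phase s)%:R) <= good_bound t s [::].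
Proof.
move=> q0 sE; rewrite /good_bound /failure_potential sE /arm_sum/= !big_geq// add0r subr0.
have := init_weight_small q0; have w0 := init_weight_ge0 (phase s).
have : (4 ^ phase s)%:R * (((4 ^ phase s)%:R - (clock s)%:R) * init_weight (phase s)) <=
    (4 ^ phase s)%:R * ((4 ^ phase s)%:R * init_weight (phase s)).
  by rewrite ler_wpM2l// ler_wpM2r// lerBlDr lerDl.
have : 1 <= (phase s)%:R :> RR by rewrite ler1n.
rewrite /later_phases; opaque_lra.
Qed.

(** Both bounds go through one induction: when the potential reaches 1, the good bound follows from
    the bad one. *)
Lemma payoff_bounds t h old xs : well_formed t h old xs ->
  ((phase_bound t (run h))%:E <= payoff (2 * t) t h (old ++ xs))%E /\
  (good_arms L mu x0 (phase (run h)) (clock (run h)) xs (arms (run h)) ->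
   ((good_bound t (run h) xs)%:E <= payoff (2 * t) t h (old ++ xs))%E).
Proof.
elim: t h old xs => [|t IH] h old xs wf; have rest0 := later_phases_ge0 wf.
  have [[_ _ szx] q0 /andP[c1 c2] _] := wf.
  have bad : ((phase_bound 0 (run h))%:E <= payoff 0 0 h (old ++ xs))%E.
    rewrite lee_fin /phase_bound mul0r.
    have : (clock (run h))%:R <= (4 ^ phase (run h))%:R :> RR by rewrite ler_nat ltnW.
    move: rest0; opaque_lra.
  split => // good.
  have [fail|ok] := leP 1 (failure_potential mu x0 (phase (run h)) (clock (run h)) xs (arms (run h))).
    by apply: le_trans bad; rewrite lee_fin; exact: (good_bound_failed wf good fail).
  rewrite lee_fin /good_bound mul0r.
  have w0 := init_weight_ge0 (phase (run h)).
  have c3 : (clock (run h))%:R <= (4 ^ phase (run h))%:R :> RR by rewrite ler_nat ltnW.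
  have pw : 0 <= ((4 ^ phase (run h))%:R - (clock (run h))%:R) * init_weight (phase (run h)).
    by rewrite mulr_ge0// subr_ge0.
  have pot0 : 0 <= asum (arm_potential mu (phase (run h))) xs (arms (run h)).
    by apply: sumr_ge0 => i _; exact: potential_ge0.
  have pot1 : asum (arm_potential mu (phase (run h))) xs (arms (run h)) < 1.
    by apply: le_lt_trans ok; rewrite /failure_potential lerDl.
  have [gsep _ _] := good.
  have R := large_gap_regret_sum inst betaE q0 c2 delta_ge0 szx good pot1 (packing gsep).
  have S : asum (excess mu delta) xs (arms (run h)) <=
      asum (large_gap_regret mu delta) xs (arms (run h)).
    apply: ler_arm_sum => // i ilt; have [_ /(_ i ilt)[h1 _ _] _] := good.
    exact: (excess_le_large_gap_regret inst).
  have : 0 <= (4 ^ phase (run h))%:R *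
      failure_potential mu x0 (phase (run h)) (clock (run h)) xs (arms (run h)).
    by rewrite mulr_ge0// addr_ge0.
  move: R S rest0; opaque_lra.
have [wfq q0 /andP[c1 c2] clk] := wf; have [_ szo szx] := wfq.
have -> : (2 * t.+1)%N = (2 * t).+2 by rewrite mulnS.
have [h' [xs' [[ph cl ba] sz' ext cov payE]]] :=
  round_payoff P x0 L_le1 oracle (2 * t) t q0 wfq.
rewrite ph in payE; rewrite payE.
set q := phase (run h) in rest0 c1 c2 q0 ph ext cov payE *.
set s := arms (run h') in sz' ext cov payE *; set b := best q s in payE *.
set x := nth x0 xs' b.
have [i0 ilt _] := cov x0.
have s0 : (0 < size s)%N by exact: leq_ltn_trans ilt.
have [blt _] := best_max q s0; rewrite -/b in blt.
pose s' r := set_nth new_arm s b (play_arm r (nth new_arm s b)).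
have szs' r : size (s' r) = size s by rewrite size_set_nth (maxn_idPr blt).
have runE r : run (rcons h' (EReward r)) =
  if (clock (run h)).+1 == (4 ^ q)%N
  then State (2 * q) (clock (run h)).+1 (base (run h) + size s) [::] false
  else State q (clock (run h)).+1 (base (run h)) (s' r) false.
  by rewrite run_rcons /= ph cl ba -/s -/b -/(s' r) szs'.
have pay0 r : (0 <= payoff (2 * t) t (rcons h' (EReward r)) (old ++ xs'))%E.
  exact: payoff_ge0.
have /andP[Dx0 Dx1] := gap_unit_interval inst x.
have integrate v bc : (forall r, 0 <= r <= 1 -> ((v + bc * (r - mu x))%:E <=
      payoff (2 * t) t (rcons h' (EReward r)) (old ++ xs'))%E) ->
    ((mu x + v)%:E <= \int[P x]_(r in `[0%R, 1%R])
      (r%:E + payoff (2 * t) t (rcons h' (EReward r)) (old ++ xs')))%E.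
  by move=> hv; exact: (reward_integral_ge inst pay0 hv).
(* Reduces the good case to a potential below 1, where the query preserves the invariant, the regret
   so far is at most B q and the best arm has a gap of at most 4 radii. *)
have split_good :
    ((phase_bound t.+1 (run h))%:E <= \int[P x]_(r in `[0%R, 1%R])
      (r%:E + payoff (2 * t) t (rcons h' (EReward r)) (old ++ xs')))%E ->
    (good_arms L mu x0 q (clock (run h)) xs' s ->
     asum (excess mu delta) xs' s = asum (excess mu delta) xs (arms (run h)) ->
     asum (arm_potential mu q) xs' s + ((4 ^ q)%:R - ((clock (run h))%:R + 1)) * init_weight q
       <= failure_potential mu x0 q (clock (run h)) xs (arms (run h)) ->
     asum (large_gap_regret mu delta) xs' s <= B * q%:R ->
     Delta x <= 4 * confidence q (nth new_arm s b) ->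
     0 <= failure_potential mu x0 q (clock (run h)) xs (arms (run h)) ->
     ((good_bound t.+1 (run h) xs)%:E <= \int[P x]_(r in `[0%R, 1%R])
      (r%:E + payoff (2 * t) t (rcons h' (EReward r)) (old ++ xs')))%E) ->
    ((phase_bound t.+1 (run h))%:E <= \int[P x]_(r in `[0%R, 1%R])
      (r%:E + payoff (2 * t) t (rcons h' (EReward r)) (old ++ xs')))%E /\
    (good_arms L mu x0 q (clock (run h)) xs (arms (run h)) ->
     ((good_bound t.+1 (run h) xs)%:E <= \int[P x]_(r in `[0%R, 1%R])
      (r%:E + payoff (2 * t) t (rcons h' (EReward r)) (old ++ xs')))%E).
  move=> bad Good; split => // good.
  have [fail|ok] := leP 1 (failure_potential mu x0 q (clock (run h)) xs (arms (run h))).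
    by apply: le_trans bad; rewrite lee_fin; exact: (good_bound_failed wf good fail).
  have [good' exS potS] := good_arms_extends inst delta q0 szx good ext.
  have w0 := init_weight_ge0 q.
  have c3 : (clock (run h))%:R + 1 <= (4 ^ q)%:R :> RR by rewrite natr1 ler_nat.
  have pw : 0 <= ((4 ^ q)%:R - ((clock (run h))%:R + 1)) * init_weight q.
    by rewrite mulr_ge0// subr_ge0.
  have pot0 : 0 <= asum (arm_potential mu q) xs' s.
    by apply: sumr_ge0 => i _; exact: potential_ge0.
  have potF : asum (arm_potential mu q) xs' s +
      ((4 ^ q)%:R - ((clock (run h))%:R + 1)) * init_weight q
      <= failure_potential mu x0 q (clock (run h)) xs (arms (run h)).
    rewrite /failure_potential; move: potS; opaque_lra.
  have pot1 : asum (arm_potential mu q) xs' s < 1.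
    by move: ok potF pw; opaque_lra.
  apply: Good => //.
  - apply: (large_gap_regret_sum inst betaE q0 c2 delta_ge0 sz' good' pot1).
    by apply: packing; case: good'.
  - exact: (best_gap inst q0 c2 s0 good' pot1 cov).
  - by move: potF pot0 pw; opaque_lra.
have next_excess r : asum (excess mu delta) xs' (s' r) =
    asum (excess mu delta) xs' s + (Delta x - delta).
  by rewrite arm_sum_set_nth// /excess/= -natr1 -/x; ring.
(* In the last round of a phase the excess, this play included, is settled against B q and the arms
   are dropped. *)
have [last|nlast] := eqVneq ((clock (run h)).+1) (4 ^ q)%N.
  have new r : ((t%:R * (mustar mu - delta) - later_phases q)%:E <=
      payoff (2 * t) t (rcons h' (EReward r)) (old ++ xs'))%E.
    rewrite -[old ++ xs']cats0.
    have rE : run (rcons h' (EReward r)) =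
        State (2 * q) (clock (run h)).+1 (base (run h) + size s) [::] false.
      by rewrite runE last eqxx.
    have wf' : well_formed t (rcons h' (EReward r)) (old ++ xs') [::].
      rewrite /well_formed /open_query rE /=; split => //.
      - by split => //; rewrite size_cat szo sz'.
      - by rewrite muln_gt0 q0.
      - rewrite last expnM leqnn ltn_exp2l// -[X in (X < _)%N]mul1n.
        by rewrite ltn_pmul2r.
      - by rewrite addSnnS.
    have [_ /(_ _)] := IH _ _ _ wf'; rewrite rE/=.
    have g0 : good_arms L mu x0 (2 * q) (clock (run h)).+1 [::] [::].
      by split => //; rewrite /arm_sum big_geq.
    move=> /(_ g0); apply: le_trans; rewrite lee_fin.
    apply: le_trans (good_bound_new_phase _ _ _) => //=; last by rewrite muln_gt0 q0.
    by rewrite /later_phases natrM.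
  have lastR : (clock (run h))%:R + 1 = (4 ^ q)%:R :> RR by rewrite natr1 last.
  have now : ((mu x + (t%:R * (mustar mu - delta) - later_phases q))%:E <=
      \int[P x]_(r in `[0%R, 1%R])
        (r%:E + payoff (2 * t) t (rcons h' (EReward r)) (old ++ xs')))%E.
    by apply: (integrate _ 0) => r _; rewrite mul0r addr0; exact: new.
  have d0 := delta_ge0.
  apply: split_good.
    (* With one round left in the phase, the bound concedes 1, enough for the gap of [x]. *)
    apply: le_trans now; rewrite lee_fin /phase_bound -/q -natr1.
    by move: Dx1 lastR d0; rewrite /gap; opaque_lra.
  move=> good' exS _ R _ F0; apply: le_trans now.
  rewrite lee_fin /good_bound -/q -natr1.
  (* The excess does not depend on the reward, so 0 stands for any value. *)
  have : asum (excess mu delta) xs' (s' 0) <= asum (large_gap_regret mu delta) xs' s.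
    apply: ler_arm_sum => // i; rewrite szs' => ilt'.
    have [_ /(_ i ilt')[h1 _ _] _] := good'.
    apply: (excess_le_large_gap_regret inst) => //; rewrite nth_set_nth/=; case: eqP => // ->//.
  rewrite next_excess exS.
  have : 0 <= (4 ^ q)%:R * failure_potential mu x0 q (clock (run h)) xs (arms (run h)).
    exact: mulr_ge0.
  by move: R lastR d0; rewrite /gap; opaque_lra.
have rE r : run (rcons h' (EReward r)) = State q (clock (run h)).+1 (base (run h)) (s' r) false.
  by rewrite runE (negbTE nlast).
have wf' r : well_formed t (rcons h' (EReward r)) old xs'.
  rewrite /well_formed /open_query rE /=; split => //.
  - by split => //; rewrite szs'.
  - by rewrite (leq_trans c1)//= ltn_neqAle nlast.
  - by rewrite addSnnS.
apply: split_good.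
  have -> : phase_bound t.+1 (run h) = mu x + (phase_bound t.+1 (run h) - mu x).
    by rewrite addrC subrK.
  apply: (integrate _ 0) => r _; rewrite mul0r addr0.
  have [+ _] := IH _ _ _ (wf' r); apply: le_trans.
  rewrite lee_fin /phase_bound rE/= -/q -[t.+1%:R]natr1 -[(clock _).+1%:R]natr1.
  have d0 := delta_ge0; by move: Dx1 d0; rewrite /gap; opaque_lra.
move=> good' exS potF R hb F0.
have [bc hbc] := @potential_step _ (4 ^ q).+1 (log_budget q) (1 - mu x)
  (nth new_arm s b).1 (nth new_arm s b).2 (loss_unit_interval inst x).
have -> : good_bound t.+1 (run h) xs = mu x + (good_bound t.+1 (run h) xs - mu x).
  by rewrite addrC subrK.
(* The loss 1 - r changes the potential by at most [- bc * (r - mu x)] beyond its old value, and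
   [good_bound] weighs the potential by [- 4 ^ q]. *)
apply: (integrate _ ((4 ^ q)%:R * bc)) => r r01.
have [_ /(_ _)] := IH _ _ _ (wf' r); rewrite rE/=.
move=> /(_ (good_arms_play blt r01 good' hb)); apply: le_trans; rewrite lee_fin.
rewrite /good_bound/= -/q next_excess exS.
have step_potential : failure_potential mu x0 q (clock (run h)).+1 xs' (s' r) <=
    failure_potential mu x0 q (clock (run h)) xs (arms (run h)) - bc * (r - mu x).
  apply: (@le_trans _ _ (asum (arm_potential mu q) xs' s +
    ((4 ^ q)%:R - ((clock (run h))%:R + 1)) * init_weight q - bc * (r - mu x)));
    last by move: potF; opaque_lra.
  rewrite /failure_potential arm_sum_set_nth// -/x -natr1.
  have r01' : 0 <= 1 - r <= 1 by rewrite subr_ge0 lerBlDr lerDl andbC.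
  have := hbc _ r01'; rewrite -surjective_pairing /arm_potential /play_arm; opaque_lra.
have : (4 ^ q)%:R * failure_potential mu x0 q (clock (run h)).+1 xs' (s' r) <=
  (4 ^ q)%:R * (failure_potential mu x0 q (clock (run h)) xs (arms (run h)) - bc * (r - mu x)).
  exact: ler_wpM2l.
rewrite -[t.+1%:R]natr1 /gap; opaque_lra.
Qed.

End regret_induction.

Lemma ln_ge_of_exp2 (q : nat) (x : RR) : (2 ^ q)%:R <= x -> q%:R <= 2 * ln x.
Proof.
move=> h; have x0 : 0 < x by apply: lt_le_trans h; rewrite ltr0n expn_gt0.
have : ln ((2 ^ q)%:R : RR) <= ln x by rewrite ler_ln// posrE ltr0n expn_gt0.
rewrite natrX lnXn// => hq; rewrite -[_ *+ q]mulr_natl in hq.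
have : q%:R * 2^-1 <= q%:R * ln (2 : RR) by rewrite ler_wpM2l// ln2_ge_half.
lra.
Qed.

(** * Regret as a function of the threshold tau *)

Section regret_bound.
Context {X : Type} (L : X -> X -> RR) (mu : X -> RR) (P : X -> probability RR RR).
Context (O : seq (X * RR) -> option X) (x0 : X) (c d beta : RR) (t : nat).
Hypothesis L_le1 : forall x y, L x y <= 1.
Hypothesis oracle : covering_oracle L O.
Hypothesis inst : instance L mu P.
Hypothesis c_gt0 : 0 < c.
Hypothesis zoom : zooming_ok L mu c d.
Hypothesis betaE : beta = 2 \/ (mustar mu = 1 /\ beta = 1).
Hypothesis t_ge2 : (2 <= t)%N.
Local Notation log_t := (ln (t%:R : RR)).

Lemma regret_le_of_payoff (n : nat) (v : RR) :
  (v%:E <= payoff_fuel L O P zooming n t [::] [::])%E ->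
  (regret L O P mu zooming t <= (t%:R * mustar mu - v)%:E)%E.
Proof.
move=> h; rewrite /regret EFinB; apply: leeB => //.
by apply: le_trans h _; apply: ereal_sup_ubound; exists n.
Qed.

Lemma regret_uniform_gap (D : RR) : (forall x, gap mu x <= D) ->
  (regret L O P mu zooming t <= (t%:R * D)%:E)%E.
Proof.
move=> hD; have -> : t%:R * D = t%:R * mustar mu - t%:R * (mustar mu - D) by ring.
apply: (@regret_le_of_payoff (2 * t)).
exact: (@payoff_uniform_gap _ L mu P O x0 L_le1 oracle inst D t [::] [::] [::]).
Qed.

Lemma ln_t_ge_half : 2^-1 <= log_t.
Proof.
apply: le_trans ln2_ge_half _; rewrite ler_ln ?posrE ?ltr0n// ?ler_nat//.
exact: leq_trans t_ge2.
Qed.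

(** [payoff_bounds] from the initial state with allowance [tau / 2]. In [weighted_packing] there are
    at most [6 * log_t] shells, whence 12 = 2 * 6; [8 * log_t] bounds twice the last phase. *)
Lemma regret_packing (tau D : RR) : 0 < tau <= 1 -> 1 <= t%:R * tau ->
  Num.max 1 (tau `^ (1 - (d + beta))) <= D ->
  (regret L O P mu zooming t <=
    (t%:R * (tau / 2) + (9000 * (12 * c * log_t * D) + 1) * (8 * log_t))%:E)%E.
Proof.
move=> tau01 ttau hD; have h2 := ln_t_ge_half.
have D0 : 0 <= D by apply: le_trans hD; rewrite le_max ler01.
have t0 : (0 < t)%N by exact: leq_trans t_ge2.
pose M := (trunc_log 2 t).+1.
have M1 : 1 <= 2 ^+ M * tau.
  apply: le_trans ttau _; rewrite ler_wpM2r//; first by case/andP: tau01 => /ltW.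
  by rewrite -natrX ler_nat ltnW// trunc_log_ltn.
have M2 : M.+1%:R <= 6 * log_t.
  have : (trunc_log 2 t)%:R <= 2 * log_t by apply: ln_ge_of_exp2; rewrite ler_nat trunc_logP.
  by rewrite /M -!natr1; lra.
have beta12 : 1 <= beta <= 2 by case: betaE => [->|[_ ->]]; lra.
have gap1 x : gap mu x <= 1 by case/andP: (gap_unit_interval inst x).
pose B := 9000 * (12 * c * log_t * D).
have B0 : 0 <= B.
  apply: mulr_ge0; first exact: ler0n.
  have l0 : 0 <= log_t by apply: le_trans h2; rewrite invr_ge0.
  by apply: mulr_ge0 => //; apply: mulr_ge0 => //; apply: mulr_ge0 => //; exact: ltW.
have packing xs : gap_separated L mu xs ->
    9000 * (\sum_(x <- xs | tau / 2 < gap mu x) gap mu x `^ (1 - beta)) <= B.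
  move=> sep; apply: ler_wpM2l; first exact: ler0n.
  apply: le_trans (weighted_packing zoom c_gt0 beta12 tau01 M1 gap1 sep) _.
  apply: (@le_trans _ _ (2 * c * M.+1%:R * D)).
    by apply: ler_wpM2l => //; rewrite !mulr_ge0// ltW.
  apply: ler_wpM2r => //.
  have -> : 12 * c * log_t = 2 * c * (6 * log_t) by ring.
  by apply: ler_wpM2l => //; rewrite mulr_ge0// ltW.
(* By t + 2 <= t^2, q is at most 2 ln (t^2) = 4 ln t. *)
have horizon q : (2 ^ q <= t + 2)%N -> 2 * q%:R <= 8 * log_t.
  move=> hq; have : q%:R <= 2 * (ln (t%:R ^+ 2 : RR)).
    apply: ln_ge_of_exp2; rewrite -natrX ler_nat; apply: leq_trans hq _.
    apply: (@leq_trans (t * 2)); first by rewrite muln2 -addnn leq_add2l.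
    by rewrite expnS expn1 leq_mul2l t_ge2 orbT.
  by rewrite lnXn ?ltr0n// mulr2n; lra.
have d0 : 0 <= tau / 2 by case/andP: tau01 => /ltW ? _; rewrite divr_ge0.
have wf : well_formed t t [::] [::] ([::] : seq X).
  by split => //; rewrite addnC.
have [_ /(_ _)] := payoff_bounds x0 L_le1 oracle inst betaE d0 B0 packing horizon wf.
have good : good_arms L mu x0 1 2 ([::] : seq X) [::].
  by split => //; rewrite /arm_sum big_geq.
move=> /(_ good) h.
have {}h := le_trans _ h.
have := @good_bound_new_phase X mu x0 (tau / 2) B (8 * log_t) t init_state isT erefl.
rewrite -lee_fin => /h /regret_le_of_payoff h'; apply: le_trans h' _.
by rewrite lee_fin -/B /=; move: B0; move: (B) => B'; lra.
Qed.

End regret_bound.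

Theorem mainTheorem13 :
  exists (A : algorithm) (c0 K : RR), 0 < c0 /\ 0 < K /\
  forall (X : Type) (L : X -> X -> RR), is_metric L -> (forall x y, L x y <= 1) ->
  forall (mu : X -> RR) (P : X -> probability RR RR), instance L mu P ->
  forall O : seq (X * RR) -> option X, covering_oracle L O ->
  forall c d : RR, 0 < c -> zooming_dim L mu c d ->
  forall beta : RR, (beta = 2 \/ (mustar mu = 1 /\ beta = 1)) ->
  forall t : nat, (2 <= t)%N ->
    (regret L O P mu A t <=
      (if 1 < d + beta then
         (K * c * c0 * ln t%:R ^+ 2) `^ (1 / (d + beta)) * t%:R `^ (1 - 1 / (d + beta))
       else K * c * c0 * ln t%:R ^+ 2)%:E)%E.
Proof.
have [C CE] : exists C : RR, C = 9000 by exists 9000.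
have C1 : 1 <= C by rewrite CE ler1n.
exists zooming, 1, (400 * C); split; first exact: ltr01.
have K0 : 0 < 400 * C by apply: mulr_gt0; [rewrite ltr0n | exact: lt_le_trans C1].
split; first exact: K0.
move=> X L _ L1 mu P inst O orc c d c0 [zoom _] beta betaE t t2; rewrite mulr1.
have [K KE] : exists K : RR, K = 400 * C by exists (400 * C).
rewrite -KE in K0 *.
have h2 := ln_t_ge_half t2; set l := ln _ in h2 *.
have t0 : 0 < t%:R :> RR by rewrite ltr0n; exact: leq_trans t2.
have t1 : 1 <= t%:R :> RR by rewrite ler1n; exact: leq_trans t2.
have l0 : 0 < l by apply: lt_le_trans h2; rewrite invr_gt0.
have l2 : 0 < l ^+ 2 by exact: exprn_gt0.
have num0 : 0 < K * c * l ^+ 2 by exact: mulr_gt0 (mulr_gt0 K0 c0) l2.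
have rhs0 : 0 <= (if 1 < d + beta then
    (K * c * l ^+ 2) `^ (1 / (d + beta)) * t%:R `^ (1 - 1 / (d + beta))
    else K * c * l ^+ 2).
  by case: ifP => _; [rewrite mulr_ge0// powR_ge0 | exact: ltW].
have b12 : 1 <= beta by case: betaE => [->|[_ ->]]; rewrite ?ler1n.
have [[x0]|noX] := pselect (inhabited X); last first.
  (* On an empty space the supremum takes the default value 0, and zero payoff suffices. *)
  have mu0 : mustar mu = 0.
    rewrite /mustar (_ : range mu = set0) ?sup0//.
    by apply/seteqP; split => // y [x _ _]; apply: noX.
  have h : (0%:E <= payoff_fuel L O P zooming 0 t [::] [::])%E by [].
  apply: le_trans (regret_le_of_payoff mu h) _.
  by rewrite lee_fin mu0 mulr0 subr0.
have gap01 x : 0 <= gap mu x <= 1 := gap_unit_interval inst x.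
case: ifP rhs0 => [gam1 _|/negbT gam1 rhs0]; last first.
  have [small|/existsNP[x /negP]] := pselect (forall x, gap mu x <= 0).
    by apply: le_trans (regret_uniform_gap x0 t L1 orc inst small) _; rewrite lee_fin mulr0.
  rewrite -ltNge => gx; rewrite -leNgt in gam1.
  have /andP[_ gx1] := gap01 x.
  (* Here d <= 0 because beta >= 1, so a positive gap forces c >= 1. The threshold is then 1 / t,
     for which small gaps cost at most 1/2 in total. *)
  have c1 : 1 <= c.
    have /(gap_coefficient_ge1 zoom) h : 0 < gap mu x <= 1 by rewrite gx.
    apply: le_trans h _; rewrite ler_piMr ?(ltW c0)// powR_le1 ?(ltW gx)//; lra.
  have tau01 : 0 < (t%:R^-1 : RR) <= 1 by rewrite invr_gt0 t0 invf_le1.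
  have D1 : Num.max 1 (t%:R^-1 `^ (1 - (d + beta))) <= 1 :> RR.
    rewrite ge_max lexx/= powR_le1//; last by lra.
    by case/andP: tau01 => /ltW -> ->.
  have e1 : t%:R * t%:R^-1 = 1 :> RR by rewrite divff// gt_eqF.
  have h1 : 1 <= t%:R * t%:R^-1 :> RR by rewrite e1.
  apply: le_trans (regret_packing x0 L1 orc inst c0 zoom betaE t2 tau01 h1 D1) _.
  rewrite lee_fin mulrA e1 mulr1 -/l -CE KE.
  have q1 : c * l ^+ 2 >= l ^+ 2 by rewrite ler_peMl// ltW.
  have q2 : c * l ^+ 2 <= C * (c * l ^+ 2) by rewrite ler_peMl// mulr_ge0// ltW.
  have q3 : l * 2^-1 <= l ^+ 2 by rewrite expr2 ler_wpM2l//; lra.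
  have -> : (C * (12 * c * l) + 1) * (8 * l) = 96 * (C * (c * l ^+ 2)) + 8 * l by ring.
  have -> : 400 * C * c * l ^+ 2 = 400 * (C * (c * l ^+ 2)) by ring.
  move: (C * _) q2 => Y q2; lra.
set g := d + beta in gam1 *.
pose tau := (K * c * l ^+ 2 / t%:R) `^ (1 / g).
have g0 : 0 < g by lra.
have y0 : 0 < K * c * l ^+ 2 / t%:R by rewrite divr_gt0.
have tau0 : 0 < tau by exact: powR_gt0.
have tauE : tau `^ g = K * c * l ^+ 2 / t%:R.
  by rewrite -powRrM divfK ?gt_eqF// powRr1// ltW.
have rhsE : (K * c * l ^+ 2) `^ (1 / g) * t%:R `^ (1 - 1 / g) = t%:R * tau.
  have {1}-> : K * c * l ^+ 2 = K * c * l ^+ 2 / t%:R * t%:R by rewrite divfK// gt_eqF.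
  rewrite powRM ?(ltW y0) ?(ltW t0)// -/tau -mulrA -powRD; last by rewrite (gt_eqF t0) implybT.
  by rewrite addrC subrK powRr1 ?(ltW t0)// mulrC.
rewrite rhsE.
(* If no gap exceeds tau, the bound t tau is immediate; otherwise tau < 1 and the gap of [x] bounds
   [c] from below. *)
have [small|/existsNP[x /negP]] := pselect (forall x, gap mu x <= tau).
  by apply: le_trans (regret_uniform_gap x0 t L1 orc inst small) _.
rewrite -ltNge => gx.
have /andP[gx0 gx1] := gap01 x.
have tau1 : tau < 1 by exact: lt_le_trans gx1.
have tau01 : 0 < tau <= 1 by rewrite tau0 ltW.
have gpos : 0 < gap mu x by exact: lt_trans gx.
have /(gap_coefficient_ge1 zoom) cge : 0 < gap mu x <= 1 by rewrite gpos.
(* As c >= (gap mu x) `^ d > tau `^ d, tau `^ beta >= K l ^ 2 / t. *)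
have tau_large : K * l ^+ 2 / t%:R <= tau.
  have y'0 : 0 < K * l ^+ 2 / t%:R by rewrite !divr_gt0 ?mulr_gt0.
  have tE : tau `^ g = c * (K * l ^+ 2 / t%:R) by rewrite tauE; ring.
  have [d0|d0] := leP 0 d; last first.
    (* For d < 0 the lower bound on [c] is 1, and tau^g <= tau because g > 1. *)
    have c1 : 1 <= c.
      apply: le_trans cge _; rewrite ler_piMr ?(ltW c0)// powR_le1 ?gx0//.
      by rewrite oppr_ge0 ltW.
    apply: le_trans (powR_le_base tau01 (ltW gam1)).
    by rewrite tE ler_peMl// ltW.
  apply: le_trans (powR_le_base tau01 b12).
  have cd : tau `^ d <= c.
    apply: (@le_trans _ _ (gap mu x `^ d)).
      by apply: (ge0_ler_powR d0); rewrite ?nnegrE ?(ltW tau0) ?(ltW gpos) ?(ltW gx).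
    by move: cge; rewrite powRN ler_pdivlMr ?powR_gt0// mul1r.
  have := tE; rewrite /g powRD; last by rewrite (gt_eqF tau0) implybT.
  move=> e; rewrite -(ler_pM2l (powR_gt0 d tau0)) e.
  by apply: ler_wpM2r => //; exact: ltW.
have ttau : K * l ^+ 2 <= t%:R * tau by rewrite [leRHS]mulrC -ler_pdivrMr.
have K1 : 400 <= K by rewrite KE; apply: (ler_peMr (ler0n _ _) C1).
have y1 : l <= 2 * l ^+ 2 by nra.
have ttau1 : 1 <= t%:R * tau by apply: le_trans ttau; nra.
have D1 : Num.max 1 (tau `^ (1 - g)) <= tau `^ (1 - g).
  rewrite ge_max lexx andbT -[X in X <= _]/((fun=> 1) (1 - g)) -powR1.
  by apply: powR_base_antitone; rewrite ?(ltW tau1)// subr_le0 ltW.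
apply: le_trans (regret_packing x0 L1 orc inst c0 zoom betaE t2 tau01 ttau1 D1) _.
rewrite lee_fin -/l -CE.
have split_tau : K * (c * l ^+ 2 * tau `^ (1 - g)) = t%:R * tau.
  have -> : K * (c * l ^+ 2 * tau `^ (1 - g)) = t%:R * (tau `^ g * tau `^ (1 - g)).
    by rewrite tauE; field; rewrite gt_eqF.
  rewrite -powRD; last by rewrite (gt_eqF tau0) implybT.
  by rewrite addrC subrK powRr1// ltW.
have -> : (C * (12 * c * l * tau `^ (1 - g)) + 1) * (8 * l) =
    96 * (C * (c * l ^+ 2 * tau `^ (1 - g))) + 8 * l by ring.
(* The three terms are at most 1/2, 96/400 and 16/400 of t tau, the last by l <= 2 l^2 and 400 l^2
   <= t tau. *)
move: split_tau; rewrite KE -mulrA; move: (C * _) => Y split_tau.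
have : 400 * l ^+ 2 <= K * l ^+ 2 by rewrite ler_pM2r.
lra.
Qed.
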